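(* Let $\mu,\sigma\ge0$ be constants with $\tilde\mu=\mu-\sigma^2/2>0$, let $\alpha>0$, and consider the execution problem with $b(x)\equiv-\mu$, $\sigma(x)\equiv\sigma$, $g(\zeta)=\alpha\zeta^2$ and risk-neutral utility $u_{\mathrm{RN}}(w,\varphi,s)=w$. Let $t\in(0,1]$ and $(w,\varphi,s)\in D$, and set $$\hat\Phi^1(t)=\frac{\mathrm{arctanh}\sqrt{1-e^{-2\tilde\mu t}}}{\sqrt{\alpha\tilde\mu}},\qquad \hat\Phi^2(t)=\sqrt{\frac{\tilde\mu}{\alpha}}\,t .$$ (i) If $\varphi\ge\hat\Phi^1(t)$, then $$V_t(w,\varphi,s;u_{\mathrm{RN}})=w+\frac{s\sqrt{1-e^{-2\tilde\mu t}}}{2\sqrt{\alpha\tilde\mu}},$$ and an optimal strategy is $\hat\zeta^1_r=\sqrt{\dfrac{\tilde\mu}{\alpha(1-e^{-2\tilde\mu(t-r)})}}$. (ii) If $\varphi\le\hat\Phi^2(t)$, then $$V_t(w,\varphi,s;u_{\mathrm{RN}})=w+\frac{s}{2\sqrt{\alpha\tilde\mu}}\big(1-e^{-2\sqrt{\alpha\tilde\mu}\,\varphi}\big),$$ and an optimal strategy is $\hat\zeta^2_r=\sqrt{\dfrac{\tilde\mu}{\alpha}}\,1_{[0,\varphi\sqrt{\alpha/\tilde\mu}]}(r)$.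
   Context: Let $(\Omega,\mathcal{F},(\mathcal{F}_t)_{0\le t\le 1},P)$ be a filtered probability space satisfying the usual conditions and $(B_t)_{0\le t\le 1}$ a standard one-dimensional $(\mathcal{F}_t)_t$-Brownian motion. Fix $\Phi_0>0$ and $D=\mathbb{R}\times[0,\Phi_0]\times[0,\infty)$. For $t\in[0,1]$ and $\varphi\ge0$, $\mathcal{A}_t(\varphi)$ is the set of nonnegative $(\mathcal{F}_r)_r$-progressively measurable processes $(\zeta_r)_{0\le r\le t}$ with $\int_0^t\zeta_r\,dr\le\varphi$ a.s. and $\sup_{r,\omega}\zeta_r(\omega)<\infty$. $V_t(w,\varphi,s;u)=\sup_{(\zeta_r)_r\in\mathcal{A}_t(\varphi)}E[u(W_t,\varphi_t,S_t)]$, where $(W_0,\varphi_0,S_0)=(w,\varphi,s)$, $dW_r=\zeta_rS_r\,dr$, $d\varphi_r=-\zeta_r\,dr$, and (for the present constant coefficients) $S_r=s\exp\big(-\mu r+\sigma B_r-\int_0^rg(\zeta_v)\,dv\big)$. Strategies are here allowed to range over the larger class $\tilde{\mathcal{A}}_t(\varphi)$ of $(\mathcal{F}_r)_r$-adapted processes $(\zeta_r)_{0\le r\le t}$ with $\zeta_r\ge0$, $\int_0^t\zeta_r\,dr\le\varphi$ and $\sup_{(r,\omega)\in[0,t-\varepsilon]\times\Omega}\zeta_r(\omega)<\infty$ for all $\varepsilon\in(0,t)$ (unbounded speed at the terminal time $t$ is allowed). A strategy $(\zeta_r)_r\in\tilde{\mathcal{A}}_t(\varphi)$ is optimal if its terminal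 cash $W_t=w+\int_0^t\zeta_rS_r\,dr$ satisfies $E[W_t]=V_t(w,\varphi,s;u_{\mathrm{RN}})$. *)

(* Defs.v *)
From HB Require Import structures.
From mathcomp Require Import all_boot all_order all_algebra.
From mathcomp Require Import all_classical all_reals all_analysis.
From mathcomp Require Import ring lra.
Import Order.TTheory GRing.Theory Num.Theory.
Import numFieldNormedType.Exports.

Set Implicit Arguments.
Unset Strict Implicit.
Unset Printing Implicit Defensive.

Local Open Scope classical_set_scope.
Local Open Scope ring_scope.

(* Time runs over [0, 1].  Families indexed by time are total functions on [R],
   constrained only at the times where the process is meant to live.           *)

Section filtrations.
Context {d : measure_display} {T : measurableType d} {R : realType}.
Variable P : probability T R.
Implicit Types (F : R -> set (set T)) (X : R -> T -> R) (r q t : R).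

Definition filtration F : Prop :=
  [/\ forall r, 0 <= r <= 1 -> sigma_algebra setT (F r),
      forall r, 0 <= r <= 1 -> F r `<=` measurable &
      forall r q, 0 <= r -> r <= q -> q <= 1 -> F r `<=` F q].

(* As [F 0] consists of measurable sets, the second clause also says that the
   ambient sigma-algebra is [P]-complete.                                     *)
Definition usual_conditions F : Prop :=
  (forall r, 0 <= r < 1 ->
     \bigcap_(q in [set q | r < q <= 1]) F q `<=` F r) /\
  P.-negligible `<=` F 0.

Definition adapted F t X : Prop :=
  forall r, 0 <= r <= t ->
    forall U : set R, measurable U -> F r (X r @^-1` U).

(* [g_sigma_algebraType (F r)] is [T] endowed with the sigma-algebra generated
   by [F r], that is [F r] itself.                                            *)
Definition progressively_measurable F t X : Prop :=
  forall r, 0 <= r <= t ->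
    @measurable_fun _ _ (measurableTypeR R * g_sigma_algebraType (F r))%type R
      [set p | 0 <= p.1 <= r] (fun p => X p.1 p.2).

Definition increment (B : R -> T -> R) r q : T -> R := B q \- B r.

(* The variance of an increment is [q - r]; the second parameter of
   [normal_prob] is the standard deviation.                                  *)
Definition standard_brownian_motion F (B : R -> T -> R) : Prop :=
  [/\ adapted F 1 B,
      {ae P, forall x, B 0 x = 0},
      forall x, {within `[0, 1], continuous (B ^~ x)},
      forall r q, 0 <= r -> r < q -> q <= 1 ->
        forall U : set R, measurable U ->
          P (increment B r q @^-1` U) = normal_prob 0 (Num.sqrt (q - r)) U &
      forall r q, 0 <= r -> r < q -> q <= 1 ->
        forall (A : set T) (U : set R), F r A -> measurable U ->
          P (A `&` increment B r q @^-1` U) =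
            (P A * P (increment B r q @^-1` U))%E].

End filtrations.

Section execution.
Context {d : measure_display} {T : measurableType d} {R : realType}.
Variables (P : probability T R) (F : R -> set (set T)) (B : R -> T -> R).
Variables (mu sigma : R) (g : R -> R).
Implicit Types (zeta : R -> T -> R) (t w phi s r : R) (x : T).

Local Notation leb := (@lebesgue_measure R).

Definition domain (Phi0 : R) : set (R * R * R) :=
  [set p | 0 <= p.1.2 <= Phi0 /\ 0 <= p.2].

Definition admissible t phi zeta : Prop :=
  [/\ progressively_measurable F t zeta,
      forall r x, 0 <= r <= t -> 0 <= zeta r x,
      {ae P, forall x, (\int[leb]_(r in `[0%R, t]) (zeta r x)%:E <= phi%:E)%E} &
      exists M : R, forall r x, 0 <= r <= t -> zeta r x <= M].

(* Measurability of the paths is what gives meaning to the integral of [zeta];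
   adaptedness alone does not provide it.                                     *)
Definition extended_admissible t phi zeta : Prop :=
  [/\ adapted F t zeta,
      forall x, measurable_fun `[0, t] (zeta ^~ x),
      forall r x, 0 <= r <= t -> 0 <= zeta r x,
      forall x, (\int[leb]_(r in `[0%R, t]) (zeta r x)%:E <= phi%:E)%E &
      forall eps : R, 0 < eps < t ->
        exists M : R, forall r x, 0 <= r <= t - eps -> zeta r x <= M].

(* The integral of [g (zeta)] may be infinite for an unbounded [zeta]; the
   extended exponential then makes the price vanish.                       *)
Definition price s zeta r x : R :=
  s * fine (expeR ((- mu * r + sigma * B r x)%:E
                   - \int[leb]_(v in `[0%R, r]) (g (zeta v x))%:E)%E).

Definition cash w s zeta r x : R :=
  w + \int[leb]_(v in `[0, r]) (zeta v x * price s zeta v x).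

Definition shares phi zeta r x : R :=
  phi - \int[leb]_(v in `[0, r]) (zeta v x).

Definition value t w phi s (u : R -> R -> R -> R) : \bar R :=
  ereal_sup [set 'E_P[fun x => u (cash w s zeta t x) (shares phi zeta t x)
                                 (price s zeta t x)]%E
            | zeta in [set zeta | admissible t phi zeta]].

Definition u_RN (w phi s : R) : R := w.

Definition optimal_strategy t w phi s zeta : Prop :=
  extended_admissible t phi zeta /\
  'E_P[cash w s zeta t]%E = value t w phi s u_RN.

End execution.

Section explicit_formulas.
Context {R : realType}.
Implicit Types (x mt alpha t phi r : R).

Definition tanh x : R := (expR x - expR (- x)) / (expR x + expR (- x)).

Definition arctanh x : R := ln ((1 + x) / (1 - x)) / 2.

Lemma arctanhK x : -1 < x < 1 -> tanh (arctanh x) = x.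
Proof.
move=> /andP[xN1 x1]; rewrite /tanh /arctanh.
have y0 : 0 < (1 + x) / (1 - x) by apply: divr_gt0; lra.
set y := (1 + x) / (1 - x) in y0 *.
have ey : expR (ln y / 2) * expR (ln y / 2) = y.
  by rewrite -expRD -splitr lnK // posrE.
rewrite expRN; move: ey (expR_gt0 (ln y / 2)).
move: (expR (ln y / 2)) => e ey e0.
have -> : (e - e^-1) / (e + e^-1) = (y - 1) / (y + 1).
  by rewrite -ey; field; rewrite ?gt_eqF //; nra.
by rewrite /y; field; rewrite ?gt_eqF //; lra.
Qed.

Definition Phi1_hat mt alpha t : R :=
  arctanh (Num.sqrt (1 - expR (- 2 * mt * t))) / Num.sqrt (alpha * mt).

Definition Phi2_hat mt alpha t : R := Num.sqrt (mt / alpha) * t.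

(* At [r = t] the formula divides by zero, and the value given here is [0]. *)
Definition zeta1_hat mt alpha t r : R :=
  Num.sqrt (mt / (alpha * (1 - expR (- 2 * mt * (t - r))))).

Definition zeta2_hat mt alpha phi r : R :=
  Num.sqrt (mt / alpha) * \1_(`[0, phi * Num.sqrt (alpha / mt)]) r.

End explicit_formulas.

(* Main.v *)
Require Import Defs.
From HB Require Import structures.
From mathcomp Require Import all_boot all_order all_algebra.
From mathcomp Require Import all_classical all_reals all_analysis.
From mathcomp Require Import measurable_realfun ring lra.
Import Order.TTheory GRing.Theory Num.Theory.
Import numFieldNormedType.Exports.

Set Implicit Arguments.
Unset Strict Implicit.
Unset Printing Implicit Defensive.

Local Open Scope classical_set_scope.
Local Open Scope ring_scope.

(* The price is [s exp (sigma B_r - sigma^2 r / 2)] times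
   [exp (- mt r - int_0^r alpha zeta^2)].  Since the first factor is a martingale,
   the expected revenue of a strategy equals
     s E[ exp (sigma B_t - sigma^2 t / 2) J(zeta) ],
     J(zeta) = int_0^t zeta_r exp (- mt r - int_0^r alpha zeta^2) dr,
   where [J] is evaluated path by path.  The martingale has mean 1, so every
   deterministic bound on [J] bounds the value function, and a deterministic
   strategy earns exactly [s J].  The bound in (i) follows from the
   Cauchy-Schwarz inequality applied to [exp (- mt r)] and
   [zeta exp (- int alpha zeta^2)], the bound in (ii) from
   [mt + alpha zeta^2 >= 2 sqrt (alpha mt) zeta]; the given strategies attain
   equality. *)

(** The two thresholds decide which constraint binds. [Phi1_hat] is the number of shares that
    [zeta1_hat] sells in all, so above it only the horizon limits the gain; [Phi2_hat] is what the
    constant speed [sqrt (mt / alpha)] sells during a time [t], so below it only the holding does.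
    Both strategies are the equality cases of their inequalities: [alpha zeta^2 = mt] for the
    second, and for the first zeta exp (- int alpha zeta^2) proportional to exp (- mt r), an
    equation that [zeta1_hat] solves. Equality in the first also asks that the price be driven down
    to 0 at time [t], that is, for an infinite cost int_0^t alpha zeta^2. No bounded strategy does
    this, so the supremum in (i) is only approached within the admissible class, and cash must keep
    a meaning when the cost is infinite. On the other side, the upper bounds concern paths that are
    merely measurable and bounded, for which exp (- c int h) need not have a derivative at every
    time. *)

(** * Gaussian moments and integration against an independent variable *)

Section density.
Local Open Scope ereal_scope.
Context d (X : measurableType d) (R : realType).
Variables (mu nu : {measure set X -> \bar R}) (rho : X -> R).
Hypothesis mrho : measurable_fun setT rho.
Hypothesis rho0 : forall x, (0 <= rho x)%R.
Hypothesis nuE : forall A, measurable A -> nu A = \int[mu]_(x in A) (rho x)%:E.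

Import HBNNSimple.

(** Simple functions reduce to [nuE] on their fibres; monotone convergence on both sides does the
    rest. *)
Lemma ge0_integral_density (f : X -> \bar R) :
  measurable_fun setT f -> (forall x, 0 <= f x) ->
  \int[nu]_x f x = \int[mu]_x (f x * (rho x)%:E).
Proof.
move=> mf f0; pose f_ := nnsfun_approx measurableT mf.
have mf_ n : measurable_fun setT (EFin \o f_ n).
  exact/measurable_EFinP/measurable_funP.
have f_0 n x : 0 <= (EFin \o f_ n) x by rewrite lee_fin.
have rho0e x : 0 <= (rho x)%:E by rewrite lee_fin.
have mrhoe : measurable_fun setT (EFin \o rho) by exact/measurable_EFinP.
have nd_f x m n : (m <= n)%N -> (EFin \o f_ m) x <= (EFin \o f_ n) x.
  by move=> mn; rewrite lee_fin; exact/lefP/nd_nnsfun_approx.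
have cf x : (EFin \o f_ n) x @[n --> \oo] --> f x.
  by apply: cvg_nnsfun_approx => // y _; exact: f0.
transitivity (limn (fun n => \int[nu]_x (EFin \o f_ n) x)).
  rewrite -monotone_convergence//; last by move=> x _ m n; exact: nd_f.
  by apply: eq_integral => x _; exact/esym/cvg_lim.
transitivity (limn (fun n => \int[mu]_x ((EFin \o f_ n) x * (rho x)%:E))); last first.
  rewrite -monotone_convergence//.
  - by apply: eq_integral => x _; apply/cvg_lim => //; exact: cvgeZr.
  - by move=> n; exact: emeasurable_funM.
  - by move=> n x _; rewrite mule_ge0.
  - by move=> x _ m n mn; rewrite lee_wpmul2r// nd_f.
congr (limn _); apply/funext => n.
have mfn k : measurable (f_ n @^-1` [set k]).
  by rewrite -(setTI (_ @^-1` _)); exact: (measurable_funP (f_ n)).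
under [RHS]eq_integral => x _.
  rewrite /= fimfunE -fsumEFin// ge0_mule_fsuml; last first.
    by move=> k; exact: nnfun_muleindic_ge0.
  over.
under [LHS]eq_integral => x _ do rewrite /= fimfunE -fsumEFin//.
rewrite !ge0_integral_fsum//.
- apply: eq_fsbigr => k _.
  rewrite integralZl_indic_nnsfun// integral_indic// setIT nuE//.
  have [k0|k0] := ltP k 0%R.
    rewrite preimage_nnfun0// integral_set0 mule0 integral0_eq// => x _.
    by rewrite indic0 mulr0 mul0e.
  rewrite (integral_mkcond (f_ n @^-1` [set k])).
  under [RHS]eq_integral => x _ do rewrite EFinM -muleA.
  rewrite ge0_integralZl//.
  + by congr (_ * _); apply: eq_integral => x _; rewrite epatch_indic muleC.
  + apply: emeasurable_funM => //; exact/measurable_EFinP/measurable_indic.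
  + by move=> x _; rewrite mule_ge0// lee_fin.
- move=> k; apply: emeasurable_funM => //.
  exact/measurable_EFinP/measurable_funM.
- by move=> k x _; rewrite mule_ge0// nnfun_muleindic_ge0.
- by move=> k; exact/measurable_EFinP/measurable_funM.
- by move=> k x _; exact: nnfun_muleindic_ge0.
Qed.

End density.

(** Completing the square turns the integrand into a constant times the normal density with mean
    shifted to [m + c s^2], which has mass 1. The measure [nu] is kept abstract so as to be the law
    of a Brownian increment, of which only the values on measurable sets are given. *)
Lemma normal_mgf (R : realType) (m s c : R)
    (nu : {measure set (measurableTypeR R) -> \bar R}) :
  s != 0 -> (forall U, measurable U -> nu U = normal_prob m s U) ->
  (\int[nu]_y (expR (c * y))%:E)%E = (expR (c * m + c ^+ 2 * s ^+ 2 / 2))%:E.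
Proof.
move=> s0 nuE.
have mexp : measurable_fun setT (fun y : measurableTypeR R => expR (c * y)).
  by apply: (measurableT_comp (@measurable_expR R)); exact: mulrl_measurable.
have mexpe : measurable_fun setT
    (fun y : measurableTypeR R => (expR (c * y))%:E) by exact/measurable_EFinP.
rewrite (@ge0_integral_density _ (measurableTypeR R) R lebesgue_measure nu
  (normal_pdf m s) (measurable_normal_pdf m s) (normal_pdf_ge0 m s) nuE)//.
have completed_square x : expR (c * x) * normal_pdf m s x =
    expR (c * m + c ^+ 2 * s ^+ 2 / 2) * normal_pdf (m + c * s ^+ 2) s x.
  rewrite !normal_pdfE//= /normal_fun mulrCA [RHS]mulrCA -!expRD.
  by congr (_ * expR _); rewrite -mulr_natr; field.
under eq_integral => x _ do rewrite -EFinM completed_square EFinM.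
rewrite ge0_integralZl//.
- by rewrite integral_normal_pdf mule1.
- by apply/measurable_EFinP; exact: measurable_normal_pdf.
- by move=> x _; rewrite lee_fin normal_pdf_ge0.
Qed.

(** In place of conditioning on [G], the pair formed by the identity and [I] is seen as a random
    element of [T] with the sigma-algebra [G], times the line. Independence says that its law is the
    product of the marginal laws, and Tonelli factors the integral. *)
Lemma integral_indep (d : measure_display) (T : measurableType d)
    (R : realType) (P : probability T R) (G : set (set T))
    (I : T -> measurableTypeR R) (Y : T -> \bar R)
    (f : measurableTypeR R -> \bar R) :
  sigma_algebra setT G -> G `<=` measurable -> measurable_fun setT I ->
  (forall A U, G A -> measurable U ->
    P (A `&` I @^-1` U) = (P A * P (I @^-1` U))%E) ->
  measurable_fun setT (Y : g_sigma_algebraType G -> \bar R) ->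
  (forall x, 0 <= Y x)%E ->
  measurable_fun setT f -> (forall y, 0 <= f y)%E ->
  (\int[P]_x (Y x * f (I x)) = \int[P]_x Y x * \int[P]_x f (I x))%E.
Proof.
move=> sG Gm mI indep mY Y0 mf f0.
have mid : measurable_fun setT (id : T -> g_sigma_algebraType G).
  by move=> _ A; rewrite measurable_g_measurableTypeE// setTI => /Gm.
have mpair : measurable_fun setT
    (fun x => (x, I x) : (g_sigma_algebraType G * measurableTypeR R)%type).
  exact: measurable_fun_pair.
pose id' : {mfun T >-> g_sigma_algebraType G} :=
  HB.pack (id : T -> g_sigma_algebraType G) (isMeasurableFun.Build _ _ _ _ _ mid).
pose I' : {mfun T >-> measurableTypeR R} :=
  HB.pack I (isMeasurableFun.Build _ _ _ _ _ mI).
pose pair' : {mfun T >-> (g_sigma_algebraType G * measurableTypeR R)%type} :=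
  HB.pack (fun x => (x, I x) : (g_sigma_algebraType G * measurableTypeR R)%type)
   (isMeasurableFun.Build _ _ _ _ _ mpair).
pose F (p : (g_sigma_algebraType G * measurableTypeR R)%type) := (Y p.1 * f p.2)%E.
have mF : measurable_fun setT F.
  by apply: emeasurable_funM; apply: measurableT_comp.
have F0 p : (0 <= F p)%E by rewrite mule_ge0.
transitivity (\int[distribution P pair']_p F p)%E.
  by rewrite ge0_integral_distribution.
transitivity (\int[(distribution P id' \x distribution P I')%E]_p F p)%E.
  apply: eq_measure_integral => A mA _; symmetry.
  apply: (@product_measure_unique _ _ _ _ _ (distribution P id')) => // C U mC mU.
  rewrite /= /distribution /pushforward -indep//.
  by move: mC; rewrite measurable_g_measurableTypeE.
rewrite fubini_tonelli1// /fubini_F /F/=.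
under eq_integral => x _ do rewrite ge0_integralZl//.
rewrite ge0_integralZr//; last exact: integral_ge0.
by rewrite !ge0_integral_distribution.
Qed.

(** * Joint measurability in time and outcome *)

(** Freezing the process at the last point of a uniform grid gives a finite sum of products of
    measurable functions, and path continuity makes these sums converge pointwise. *)
Lemma measurable_continuous_process (d : measure_display)
    (T : measurableType d) (R : realType) (B : R -> T -> R) :
  (forall r, 0 <= r <= 1 -> measurable_fun setT (B r)) ->
  (forall x, {within `[0, 1], continuous (B ^~ x)}) ->
  measurable_fun [set p : measurableTypeR R * T | 0 <= p.1 <= 1]
    (fun p => B p.1 p.2).
Proof.
move=> mB cB.
(* The index reaches [n.+1], so that time 1 itself lies in the last cell. *)
pose h n (p : measurableTypeR R * T) : R := \sum_(k < n.+2)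
  B (k%:R / n.+1%:R) p.2 * \1_(`[k%:R / n.+1%:R, k.+1%:R / n.+1%:R[) p.1.
have hE n p : 0 <= p.1 <= 1 ->
    h n p = B ((Num.truncn (p.1 * n.+1%:R))%:R / n.+1%:R) p.2.
  move=> /andP[p0 p1].
  have /andP[kv vk] := Num.Theory.truncn_itv (mulr_ge0 p0 (ler0n R n.+1)).
  set k := Num.truncn _ in kv vk *.
  have kn : (k < n.+2)%N.
    by rewrite -(ltr_nat R) (le_lt_trans kv)// (le_lt_trans (y := n.+1%:R))//
       ?ltr_nat// ler_piMl.
  rewrite /h (bigD1 (Ordinal kn))//= big1 ?addr0.
    rewrite indicE mem_set ?mulr1//= in_itv/=.
    by rewrite ler_pdivrMr// ltr_pdivlMr// kv.
  move=> j jk; rewrite indicE memNset ?mulr0//= in_itv/=.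
  rewrite ler_pdivrMr// ltr_pdivlMr// => /andP[jv vj]; move: jk.
  apply/negP; rewrite negbK; apply/eqP/val_inj => /=; apply/esym.
  by apply/eqP; rewrite Num.Theory.truncn_eq ?mulr_ge0// jv.
have mD : measurable [set p : measurableTypeR R * T | 0 <= p.1 <= 1].
  rewrite (_ : mkset _ = `[0, 1]%classic `*` setT); first exact: measurableX.
  by apply/seteqP; split => p /=; rewrite in_itv/= => //; tauto.
apply: (@measurable_fun_cvg _ _ _ _ h).
  move=> n; apply: measurable_sum => k; apply: measurable_funM.
    have kn : 0 <= (k%:R / n.+1%:R : R) <= 1.
      by rewrite divr_ge0// ler_pdivrMr// mul1r ler_nat -ltnS ltn_ord.
    apply: measurable_funTS; apply: (measurableT_comp (mB _ kn)).
    exact: measurable_snd.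
  apply: measurable_funTS.
  apply: (measurableT_comp (f := \1_(`[k%:R / n.+1%:R, k.+1%:R / n.+1%:R[) : measurableTypeR R -> R)).
    apply: measurable_indic.
    exact: measurable_itv.
  exact: measurable_fst.
move=> p /= p01.
set v := fun n => (Num.truncn (p.1 * n.+1%:R))%:R / n.+1%:R : R.
have v01 n : 0 <= v n <= 1.
  have /andP[p0 p1] := p01.
  rewrite divr_ge0//= ler_pdivrMr// mul1r (le_trans (y := p.1 * n.+1%:R))//.
    by have /andP[] := Num.Theory.truncn_itv (mulr_ge0 p0 (ler0n R n.+1)).
  by rewrite ler_piMl.
rewrite (_ : h ^~ p = (B ^~ p.2) \o v); last first.
  by apply/funext => n; rewrite /= hE.
have vp : v n @[n --> \oo] --> (p.1 : R).
  apply: (@squeeze_cvgr _ _ _ _ (fun n => p.1 - n.+1%:R^-1) (cst p.1)).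
  - near=> n; have /andP[p0 p1] := p01.
    have /andP[kv vk] := Num.Theory.truncn_itv (mulr_ge0 p0 (ler0n R n.+1)).
    rewrite /v ler_pdivrMr// kv andbT ler_pdivlMr// mulrBl mulVf//.
    by rewrite lerBlDr -natr1 ?natr1 ltW.
  - rewrite -[X in _ --> X]subr0; apply: cvgB; first exact: cvg_cst.
    exact: cvg_harmonic.
  - exact: cvg_cst.
(* Paths are continuous only relative to [[0, 1]], hence the check that the grid times [v n] stay in
   that interval. *)
have /subspace_continuousP/(_ p.1) := cB p.2.
rewrite /= in_itv/= => /(_ p01); apply: cvg_comp.
move=> U; rewrite /= nbhs_simpl /within/= => pU.
near=> n; have : `[0, 1]%classic (v n) by rewrite /= in_itv/= v01.
by near: n; exact: (vp _ pU).
Unshelve. all: by end_near. Qed.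

(** The variable upper limit becomes the indicator of the measurable set [q <= p.1]; what remains is
    the measurability of partial integrals in Tonelli's theorem. *)
Lemma measurable_integral_itv (d : measure_display) (T : measurableType d)
    (R : realType) (f : measurableTypeR R * T -> \bar R) :
  measurable_fun setT f -> (forall p, 0 <= f p)%E ->
  measurable_fun setT (fun p : measurableTypeR R * T =>
    \int[lebesgue_measure]_(q in `[0%R, p.1]) f (q, p.2))%E.
Proof.
move=> mf f0.
pose g (u : (measurableTypeR R * T) * measurableTypeR R) : \bar R :=
  (f (u.2, u.1.2) * (\1_[set w : (measurableTypeR R * T) * measurableTypeR R | (0 <= w.2 <= w.1.1)%R] u)%:E)%E.
have mg : measurable_fun setT g.
  apply: emeasurable_funM.
    apply: measurableT_comp => //; apply: measurable_fun_pair => //.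
    exact: measurableT_comp.
  apply/measurable_EFinP/measurable_indic.
  rewrite (_ : mkset _ = (fun u : (measurableTypeR R * T) * measurableTypeR R =>
      0 <= u.2) @^-1` [set true] `&` (fun u => u.2 <= u.1.1) @^-1` [set true]);
      last first.
    by apply/seteqP; split => u /= /andP.
  have m1 : measurable_fun setT
      (fun u : (measurableTypeR R * T) * measurableTypeR R => u.1.1 : R).
    by move=> _ A mA; exact: (measurableT_comp measurable_fst measurable_fst).
  have m2 : measurable_fun setT
      (fun u : (measurableTypeR R * T) * measurableTypeR R => u.2 : R).
    by move=> _ A mA; exact: measurable_snd.
  by apply: measurableI; rewrite -[X in measurable X]setTI;
    apply: measurable_fun_ler.
have g0 u : (0 <= g u)%E by rewrite mule_ge0.
have := @measurable_fun_fubini_tonelli_F _ _ _ _ R (@lebesgue_measure R) g mg g0.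
congr (measurable_fun _ _); apply/funext => p.
rewrite /fubini_F /g [RHS]integral_mkcond; apply: eq_integral => q _.
rewrite patchE/= indicE; case: ifPn => [|].
  by rewrite inE/= in_itv/= => qp; rewrite mem_set// mule1.
by rewrite notin_setE/= in_itv/= => qp; rewrite memNset// mule0.
Qed.

(* The factor [exp (- int_0^v g (f))] by which selling lowers the price; it is
   [0] when the integral is infinite. *)
Definition discount (R : realType) (alpha : R) (f : R -> R) (v : R) : R :=
  fine (expeR (- \int[lebesgue_measure]_(q in `[0%R, v]) (alpha * f q ^+ 2)%:E)).

(* The revenue of a deterministic strategy per unit of initial price, once the
   exponential martingale [exp (sigma B - sigma^2 r / 2)] has been factored out:
   this leaves the drift [mu - sigma^2 / 2]. *)
Definition gain (R : realType) (mt alpha : R) (f : R -> R) (t : R) : \bar R :=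
  (\int[lebesgue_measure]_(v in `[0%R, t])
    (f v * (expR (- mt * v) * discount alpha f v))%:E)%E.

(** Progressive measurability concerns the strip [[0, r]] only, whereas Tonelli's theorem is applied
    to functions measurable on the whole product; extension by 0 bridges the two. *)
Definition cutoff (R : realType) (T : Type) (z : R -> T -> R) (r v : R) (x : T) : R :=
  if 0 <= v <= r then z v x else 0.

(** * The impact factor as a measurable function of time and path *)

Section discount.
Context {R : realType}.
Implicit Types (f g : R -> R) (alpha v a : R).

Lemma cost_ge0 alpha f v : 0 <= alpha ->
  (0 <= \int[lebesgue_measure]_(q in `[0%R, v]) (alpha * f q ^+ 2)%:E)%E.
Proof.
by move=> a0; apply: integral_ge0 => q _; rewrite lee_fin mulr_ge0 ?sqr_ge0.
Qed.

Lemma discount_ge0 alpha f v : 0 <= discount alpha f v.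
Proof. by rewrite fine_ge0// expeR_ge0. Qed.

Lemma eq_discount alpha f g v : (forall q, 0 <= q <= v -> f q = g q) ->
  discount alpha f v = discount alpha g v.
Proof.
move=> fg; congr (fine (expeR (- _)%E)); apply: eq_integral => q.
by rewrite inE/= in_itv/= => /fg ->.
Qed.

(** A nonnegative cost keeps the extended exponential finite; for an infinite cost both sides are
    0. *)
Lemma fine_expeRB_discount alpha f v a : 0 <= alpha ->
  fine (expeR (a%:E - \int[lebesgue_measure]_(q in `[0%R, v])
    (alpha * f q ^+ 2)%:E)) = expR a * discount alpha f v.
Proof.
move=> a0; rewrite expeRD fineM//.
by have := cost_ge0 f v a0; rewrite /discount; case: integral.
Qed.

(** The function is 0 at both infinities, since [fine] sends [+oo] to 0, whereas [expR (fine y)] is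
    1 there; the indicator corrects this. *)
Lemma measurable_fine_expeR : measurable_fun setT (fun y : \bar R => fine (expeR y)).
Proof.
rewrite (_ : (fun y => _) = fun y : \bar R =>
    expR (fine y) * \1_(~` ([set -oo%E] `|` [set +oo%E])) y).
  apply: measurable_funM; first exact: measurableT_comp.
  apply/measurable_indic/measurableC/measurableU; exact: emeasurable_set1.
apply/funext => -[y||]; rewrite indicE /=.
- by rewrite mem_set ?mulr1//= => -[].
- by rewrite memNset ?mulr0//= => /(_ (or_intror erefl)).
- by rewrite memNset ?mulr0//= => /(_ (or_introl erefl)).
Qed.

Lemma measurable_discount d (T : measurableType d) alpha (z : R -> T -> R) :
  0 <= alpha ->
  measurable_fun setT (fun p : measurableTypeR R * T => z p.1 p.2) ->
  measurable_fun setT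
    (fun p : measurableTypeR R * T => discount alpha (z ^~ p.2) p.1).
Proof.
move=> a0 mz.
have mg : measurable_fun setT
    (fun p : measurableTypeR R * T => (alpha * z p.1 p.2 ^+ 2)%:E).
  by apply/measurable_EFinP/measurable_funM => //; exact: measurable_funX.
apply: (measurableT_comp measurable_fine_expeR).
apply: measurableT_comp => //.
apply: (measurable_integral_itv mg) => p.
by rewrite lee_fin mulr_ge0 ?sqr_ge0.
Qed.

End discount.

(** * The exponential martingale *)

Section change_of_measure.
Context {d : measure_display} {T : measurableType d} {R : realType}.
Variables (P : probability T R) (F : R -> set (set T)) (B : R -> T -> R).
Hypothesis (filF : filtration F) (bmB : standard_brownian_motion P F B).

Lemma measurable_brownian r : 0 <= r <= 1 -> measurable_fun setT (B r).
Proof.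
case: bmB => aB _ _ _ _ r01 _ U mU; rewrite setTI.
by case: filF => _ Fm _; apply: (Fm _ r01); exact: aB.
Qed.

Lemma increment_mgf r q c : 0 <= r -> r < q -> q <= 1 ->
  (\int[P]_x (expR (c * increment B r q x))%:E)%E =
  (expR (c ^+ 2 * (q - r) / 2))%:E.
Proof.
move=> r0 rq q1.
have mI : measurable_fun setT (increment B r q : T -> measurableTypeR R).
  move=> mT U mU; apply: measurable_funB => //; apply: measurable_brownian.
    by rewrite (le_trans r0 (ltW rq)).
  by rewrite r0 (le_trans (ltW rq)).
pose I' : {mfun T >-> measurableTypeR R} :=
  HB.pack (increment B r q : T -> measurableTypeR R)
    (isMeasurableFun.Build _ _ _ _ _ mI).
have := @normal_mgf R 0 (Num.sqrt (q - r)) c (distribution P I').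
rewrite mulr0 add0r sqr_sqrtr ?subr_ge0 ?ltW// => <-.
- rewrite ge0_integral_distribution//.
    apply/measurable_EFinP; apply: (measurableT_comp (@measurable_expR R)).
    exact: mulrl_measurable.
- by rewrite gt_eqF// sqrtr_gt0 subr_gt0.
- by move=> U mU; case: bmB => _ _ _ nB _; exact: nB.
Qed.

(** The martingale property tested against nonnegative [Y] known at time [r], which avoids
    conditional expectations and integrability conditions. It follows from splitting [B q] into
    [B r] and an independent increment. *)
Lemma brownian_exp_martingale r q c (Y : T -> \bar R) :
  0 <= r -> r <= q -> q <= 1 ->
  measurable_fun setT (Y : g_sigma_algebraType (F r) -> \bar R) ->
  (forall x, 0 <= Y x)%E ->
  (\int[P]_x (Y x * (expR (c * B q x))%:E) =
   \int[P]_x (Y x * (expR (c * B r x))%:E) * (expR (c ^+ 2 * (q - r) / 2))%:E)%E.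
Proof.
move=> r0; rewrite le_eqVlt => /predU1P[<- _ _ _|rq q1 mY Y0].
  by rewrite subrr mulr0 mul0r expR0 mule1.
have r01 : 0 <= r <= 1 by rewrite r0 (le_trans (ltW rq)).
have mI : measurable_fun setT (increment B r q : T -> measurableTypeR R).
  move=> mT U mU; apply: measurable_funB => //; apply: measurable_brownian => //.
  by rewrite (le_trans r0 (ltW rq)).
have [sF Fm _] := filF.
have [aB _ _ _ iB] := bmB.
have mexp : measurable_fun setT (fun y : measurableTypeR R => (expR (c * y))%:E).
  apply/measurable_EFinP; apply: (measurableT_comp (@measurable_expR R)).
  exact: mulrl_measurable.
have mYB : measurable_fun setT
    ((fun x => Y x * (expR (c * B r x))%:E)%E : g_sigma_algebraType (F r) -> \bar R).
  apply: emeasurable_funM => //.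
  apply: (measurableT_comp mexp) => _ U mU; rewrite setTI.
  rewrite measurable_g_measurableTypeE; last exact: sF.
  by apply: aB => //; rewrite r0 lexx.
rewrite -(increment_mgf c r0 rq q1).
rewrite -(integral_indep (sF _ r01) (Fm _ r01) mI _ mYB _ mexp)//.
- apply: eq_integral => x _; rewrite -muleA -EFinM -expRD -mulrDr.
  by rewrite /increment/= addrC subrK.
- by move=> A U FA mU; exact: iB.
- by move=> x; rewrite mule_ge0.
Qed.

End change_of_measure.

(** * From expected cash to the pathwise gain *)

Definition revenue (T : Type) (R : realType) (B : R -> T -> R)
    (mu sigma alpha : R) (z : R -> T -> R) (v : R) (x : T) : R :=
  z v x * (expR (- mu * v + sigma * B v x) * discount alpha (z ^~ x) v).

Lemma revenue_ge0 (T : Type) (R : realType) (B z : R -> T -> R)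
    (mu sigma alpha v : R) (x : T) :
  0 <= z v x -> 0 <= revenue B mu sigma alpha z v x.
Proof. by move=> z0; rewrite mulr_ge0// mulr_ge0 ?expR_ge0// discount_ge0. Qed.

Section expected_gain.
Context {d : measure_display} {T : measurableType d} {R : realType}.
Variables (P : probability T R) (F : R -> set (set T)) (B : R -> T -> R).
Hypothesis (filF : filtration F) (bmB : standard_brownian_motion P F B).
Variables (mu sigma alpha t : R) (z : R -> T -> R).
Hypotheses (alpha0 : 0 <= alpha) (t01 : 0 < t <= 1).
Hypothesis mz : progressively_measurable F t z.
Hypothesis z0 : forall r x, 0 <= r <= t -> 0 <= z r x.

Let measurable_time_strip d' (T' : measurableType d') (r : R) :
  measurable [set p : measurableTypeR R * T' | 0 <= p.1 <= r].
Proof.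
rewrite (_ : mkset _ = `[0, r]%classic `*` setT); first exact: measurableX.
by apply/seteqP; split => p /=; rewrite in_itv/= => //; tauto.
Qed.

Let cutoffE r v x : 0 <= v <= r -> cutoff z r v x = z v x.
Proof. by rewrite /cutoff => ->. Qed.

Let cutoff_ge0 v x : 0 <= cutoff z t v x.
Proof. by rewrite /cutoff; case: ifPn => // /z0. Qed.

Let measurable_cutoff r : 0 <= r <= t -> measurable_fun setT
  (fun p : (measurableTypeR R * g_sigma_algebraType (F r))%type =>
    cutoff z r p.1 p.2).
Proof.
move=> r0t; have := mz r0t.
move/(measurable_restrictT _ (measurable_time_strip r)).
apply: eq_measurable_fun => p _; rewrite patchE /cutoff.
by case: ifPn => [|/negP pr]; [rewrite inE/= => ->|rewrite ifF//; apply/negP => h; apply: pr; rewrite inE].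
Qed.

(** The part of the revenue rate determined by the strategy; the remaining factor depends on [v] and
    [B v x] alone. *)
Let X v x := cutoff z t v x * discount alpha (cutoff z t ^~ x) v.

Let X_ge0 v x : 0 <= X v x.
Proof. by rewrite mulr_ge0// discount_ge0. Qed.

Let measurable_X : measurable_fun setT
  (fun p : measurableTypeR R * T => X p.1 p.2).
Proof.
have tt : 0 <= t <= t by rewrite lexx andbT ltW//; case/andP: t01.
have mc : measurable_fun setT
    (fun p : measurableTypeR R * T => cutoff z t p.1 p.2).
  have mid : measurable_fun setT
      (fun p : measurableTypeR R * T =>
        (p.1, p.2) : (measurableTypeR R * g_sigma_algebraType (F t))%type).
    apply: measurable_fun_pair; first exact: measurable_fst.
    move=> _ A; case: filF => sF Fm _.
    have t01' : 0 <= t <= 1 by case/andP: t01 => /ltW -> ->.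
    rewrite measurable_g_measurableTypeE; last exact: sF.
    by move=> /(Fm _ t01') mA; exact: measurable_snd.
  exact: (measurableT_comp (measurable_cutoff tt) mid).
apply: measurable_funM => //.
exact: (measurable_discount alpha0 mc).
Qed.

(** The discount at time [v] looks at the path on [[0, v]] only, so the cutoff at [t] can be
    replaced by the cutoff at [v], to which progressive measurability at time [v] applies. *)
Let adapted_X v : 0 <= v <= t ->
  measurable_fun setT ((fun x => (X v x)%:E) : g_sigma_algebraType (F v) -> \bar R).
Proof.
move=> vt; apply/measurable_EFinP.
have -> : X v = fun x => cutoff z v v x * discount alpha (cutoff z v ^~ x) v.
  have v0 : 0 <= v by case/andP: vt.
  apply/funext => x; rewrite /X !cutoffE// ?v0 ?lexx//; congr (_ * _).
  apply: eq_discount => q /andP[q0 qv]; rewrite !cutoffE// ?q0//.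
  by rewrite (le_trans qv)//; case/andP: vt.
apply: (measurable_funM (measurable_fun_pair2 _ (measurable_cutoff vt))).
exact: (measurable_fun_pair2 _ (measurable_discount alpha0 (measurable_cutoff vt))).
Qed.

Let mt := mu - sigma ^+ 2 / 2.

Let zX v x : 0 <= v <= t -> z v x * discount alpha (z ^~ x) v = X v x.
Proof.
move=> v0t; rewrite /X cutoffE//; congr (_ * _); apply: eq_discount => q.
move=> /andP[q0 qv]; rewrite cutoffE// q0 (le_trans qv)//.
by case/andP: v0t.
Qed.

Let X0 v x : ~~ (0 <= v <= t) -> X v x = 0.
Proof. by move=> /negbTE vt; rewrite /X /cutoff vt mul0r. Qed.

Let XE (k : R -> R) x : (\int[lebesgue_measure]_(v in `[0%R, t])
  (z v x * (k v * discount alpha (z ^~ x) v))%:E =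
  \int[lebesgue_measure]_v (X v x * k v)%:E)%E.
Proof.
rewrite integral_mkcond; apply: eq_integral => v _; rewrite patchE.
case: ifPn => [|].
  by rewrite inE/= in_itv/= => vt; rewrite -zX// mulrAC mulrA.
rewrite notin_setE/= in_itv/= => /negP vt.
by rewrite X0// mul0r.
Qed.

Let vt1 v : 0 <= v <= t -> 0 <= v <= 1.
Proof. by case/andP: t01 => _ t1 /andP[-> /le_trans->]. Qed.

Let BB v x := if 0 <= v <= 1 then B v x else 0.

Let mBB : measurable_fun setT (fun p : measurableTypeR R * T => BB p.1 p.2).
Proof.
have := @measurable_continuous_process _ _ _ B (measurable_brownian filF bmB).
move=> /(_ _)/wrap[]; first by case: bmB.
move/(measurable_restrictT _ (measurable_time_strip 1)).
apply: eq_measurable_fun => p _; rewrite patchE /BB.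
have [p1|/negP p1] := boolP (0 <= p.1 <= 1); first by rewrite mem_set.
by rewrite memNset.
Qed.

Let mlin k : measurable_fun setT (fun p : measurableTypeR R * T => expR (k * p.1)).
Proof.
by apply: (measurableT_comp (@measurable_expR R)); exact: measurable_funM.
Qed.

Let G1 (p : measurableTypeR R * T) :=
  X p.1 p.2 * expR (- mu * p.1 + sigma * BB p.1 p.2).

Let mG1 : measurable_fun setT G1.
Proof.
apply: measurable_funM => //.
under eq_fun do rewrite expRD.
apply: measurable_funM; first exact: mlin.
by apply: (measurableT_comp (@measurable_expR R)); exact: measurable_funM.
Qed.

Let revenueE v x : 0 <= v <= t -> revenue B mu sigma alpha z v x = G1 (v, x).
Proof.
by move=> vt; rewrite /revenue /G1/= /BB (vt1 vt) -zX// mulrAC mulrA.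
Qed.

Lemma measurable_revenue x :
  measurable_fun (`[0, t] : set (measurableTypeR R))
    (fun v => revenue B mu sigma alpha z v x).
Proof.
apply: (eq_measurable_fun (fun v => G1 (v, x))).
  by move=> v; rewrite inE/= in_itv/= => /revenueE ->.
by apply: measurable_funTS; exact: (measurableT_comp mG1 (measurable_pair2 x)).
Qed.

Let integral_revenueE x : (\int[lebesgue_measure]_(v in `[0%R, t])
    (revenue B mu sigma alpha z v x)%:E =
  \int[lebesgue_measure]_v (G1 (v, x))%:E)%E.
Proof.
rewrite XE; apply: eq_integral => v _; rewrite /G1/=.
have [/vt1 vt|/X0->] := boolP (0 <= v <= t); last by rewrite !mul0r.
by rewrite /BB vt.
Qed.

Lemma measurable_integral_revenue : measurable_fun setT (fun x =>
  \int[lebesgue_measure]_(v in `[0%R, t])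
    (revenue B mu sigma alpha z v x)%:E)%E.
Proof.
have mG1e : measurable_fun setT (EFin \o G1) by exact/measurable_EFinP.
have G1_ge0 p : (0 <= (EFin \o G1) p)%E by rewrite lee_fin mulr_ge0// expR_ge0.
have := measurable_fun_fubini_tonelli_G (m1 := @lebesgue_measure R) _ mG1e G1_ge0.
by apply: eq_measurable_fun => x _; rewrite integral_revenueE.
Qed.

Let mXe : measurable_fun setT
  (fun p : measurableTypeR R * T => (X p.1 p.2 * expR (- mt * p.1))%:E).
Proof. by apply/measurable_EFinP; apply: measurable_funM => //; exact: mlin. Qed.

Lemma measurable_gain : measurable_fun setT (fun x => gain mt alpha (z ^~ x) t).
Proof.
have X_ge0' (p : measurableTypeR R * T) :
  (0 <= (X p.1 p.2 * expR (- mt * p.1))%:E)%E.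
  by rewrite lee_fin mulr_ge0// expR_ge0.
have := measurable_fun_fubini_tonelli_G (m1 := @lebesgue_measure R) _ mXe X_ge0'.
by apply: eq_measurable_fun => x _; rewrite /gain XE.
Qed.

(** After Tonelli, fix [v]. Since [X v] is known at time [v], the martingale property replaces [B v]
    by [B t] up to a constant. As [B t] no longer varies with [v], its exponential can be taken out
    of the time integral. *)
Lemma expected_gain :
  (\int[P]_x \int[lebesgue_measure]_(v in `[0%R, t])
     (revenue B mu sigma alpha z v x)%:E =
   \int[P]_x ((expR (sigma * B t x - sigma ^+ 2 * t / 2))%:E
              * gain mt alpha (z ^~ x) t))%E.
Proof.
have /andP[t_gt0 t1] := t01.
under eq_integral do rewrite integral_revenueE.
have mBt : measurable_fun setT (B t).
  by apply: (measurable_brownian filF bmB); rewrite ltW ?t_gt0 ?t1.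
pose G2 (p : measurableTypeR R * T) :=
  ((expR (sigma * B t p.2 - sigma ^+ 2 * t / 2))%:E
   * (X p.1 p.2 * expR (- mt * p.1))%:E)%E.
have mG1e : measurable_fun setT (EFin \o G1) by exact/measurable_EFinP.
have mE : measurable_fun setT
    (fun x => (expR (sigma * B t x - sigma ^+ 2 * t / 2))%:E).
  apply/measurable_EFinP; apply: (measurableT_comp (@measurable_expR R)).
  by apply: measurable_funB => //; exact: measurable_funM.
have mG2 : measurable_fun setT G2.
  apply: emeasurable_funM => //.
  by apply: (measurableT_comp mE); exact: measurable_snd.
have G1_ge0 p : (0 <= (EFin \o G1) p)%E by rewrite lee_fin mulr_ge0// expR_ge0.
have G2_ge0 p : (0 <= G2 p)%E.
  by rewrite mule_ge0// lee_fin ?expR_ge0// mulr_ge0// expR_ge0.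
transitivity (\int[P]_x \int[lebesgue_measure]_v G2 (v, x))%E; last first.
  apply: eq_integral => x _; rewrite /gain XE /G2/= -ge0_integralZl//.
  - exact: (measurableT_comp mXe (measurable_pair2 x)).
  - by move=> v _; rewrite lee_fin mulr_ge0// expR_ge0.
rewrite -(fubini_tonelli (m1 := lebesgue_measure) (m2 := P) (EFin \o G1))//.
rewrite -(fubini_tonelli (m1 := lebesgue_measure) (m2 := P) G2)//.
apply: eq_integral => v _; rewrite /G1 /G2/=.
have [vt|/X0 Xv] := boolP (0 <= v <= t); last first.
  by under eq_integral do rewrite Xv mul0r; under [RHS]eq_integral do rewrite Xv mul0r mule0.
have v1 := vt1 vt; rewrite /BB v1.
have /andP[v0 v_t] := vt.
have := brownian_exp_martingale filF bmB sigma v0 v_t t1 (adapted_X vt).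
move=> /(_ (fun x => _))/wrap[x|martingale]; first by rewrite lee_fin.
have mX : measurable_fun setT (X v).
  have /measurable_EFinP mX := adapted_X vt.
  move=> _ U mU; have := mX measurableT U mU; case: filF => sF Fm _.
  rewrite measurable_g_measurableTypeE; last exact: sF.
  exact: Fm.
have mBv : measurable_fun setT (B v) by exact: measurable_brownian filF bmB _ v1.
have mexpB r : measurable_fun setT (B r) -> measurable_fun setT
    (fun x => ((X v x)%:E * (expR (sigma * B r x))%:E)%E).
  move=> mB; apply/measurable_EFinP; apply: measurable_funM => //.
  by apply: (measurableT_comp (@measurable_expR R)); exact: measurable_funM.
have Xexp_ge0 r x : (0 <= (X v x)%:E * (expR (sigma * B r x))%:E)%E.
  by rewrite mule_ge0// lee_fin// expR_ge0.
transitivity ((expR (- mu * v))%:E *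
    \int[P]_x ((X v x)%:E * (expR (sigma * B v x))%:E))%E.
  rewrite -ge0_integralZl//; last exact: mexpB.
  by apply: eq_integral => x _; rewrite -!EFinM expRD mulrCA.
(* The exponents balance: [- mt v - sigma^2 t / 2 + sigma^2 (t - v) / 2 = - mu v]. *)
transitivity ((expR (- mt * v - sigma ^+ 2 * t / 2))%:E *
    \int[P]_x ((X v x)%:E * (expR (sigma * B t x))%:E))%E; last first.
  rewrite -ge0_integralZl//; last exact: mexpB.
  apply: eq_integral => x _; rewrite -!EFinM !expRD; congr (_%:E); ring.
rewrite martingale muleCA -EFinM muleC -expRD; congr (_ * (expR _)%:E)%E.
by rewrite /mt; field.
Qed.

End expected_gain.

(** At an infinite [y] both sides are 0, whatever the sign of [s]. Thus the initial price can be
    factored out of the cash on every path, even one of infinite revenue. *)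
Lemma fine_mulEFin (R : realType) (s : R) (y : \bar R) :
  fine (s%:E * y) = s * fine y.
Proof.
case: y => [y||] //=; rewrite mulr0.
  by rewrite mulry; case: sgrP; rewrite ?mul0e ?mul1e ?mulN1e.
by rewrite mulrNy; case: sgrP; rewrite ?mul0e ?mul1e ?mulN1e.
Qed.

Section expected_cash.
Context {d : measure_display} {T : measurableType d} {R : realType}.
Variables (P : probability T R) (F : R -> set (set T)) (B : R -> T -> R).
Hypothesis (filF : filtration F) (bmB : standard_brownian_motion P F B).
Variables (mu sigma alpha t : R).
Hypotheses (alpha0 : 0 <= alpha) (t01 : 0 < t <= 1).
Let mt := mu - sigma ^+ 2 / 2.
Let g := fun y : R => alpha * y ^+ 2.

Let density x := expR (sigma * B t x - sigma ^+ 2 * t / 2).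

Let mBt : measurable_fun setT (B t).
Proof.
have /andP[t_gt0 t1] := t01.
by apply: (measurable_brownian filF bmB); rewrite ltW ?t_gt0 ?t1.
Qed.

Let mdensity : measurable_fun setT density.
Proof.
apply: (measurableT_comp (@measurable_expR R)).
by apply: measurable_funB => //; exact: measurable_funM.
Qed.

Let integral_density : (\int[P]_x (density x)%:E = 1)%E.
Proof.
have /andP[t_gt0 t1] := t01.
have B0 := measurable_brownian filF bmB (r := 0).
have := brownian_exp_martingale filF bmB sigma (lexx 0) (ltW t_gt0) t1
  (measurable_cst 1%E).
move=> /(_ (fun=> lee01))/= => martingale.
transitivity ((expR (- (sigma ^+ 2 * t / 2)))%:E *
   \int[P]_x (1 * (expR (sigma * B t x))%:E))%E.
  rewrite -ge0_integralZl//.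
  - by apply: eq_integral => x _; rewrite mul1e -EFinM -expRD addrC.
  - under eq_fun do rewrite mul1e.
    apply/measurable_EFinP; apply: (measurableT_comp (@measurable_expR R)).
    exact: measurable_funM.
rewrite martingale subr0.
rewrite (_ : (\int[P]_x _)%E = 1%E).
  by rewrite mul1e -EFinM -expRD addNr expR0.
(* [B 0] vanishes only almost surely. *)
transitivity (\int[P]_x (cst 1%E x))%E.
  apply: ae_eq_integral => //.
    under eq_fun do rewrite mul1e.
    apply/measurable_EFinP; apply: (measurableT_comp (@measurable_expR R)).
    by apply: measurable_funM => //; apply: B0; rewrite lexx ler01.
  case: bmB => _ B00 _ _ _; apply: filterS B00 => x Bx _.
  by rewrite Bx mulr0 expR0 mul1e.
by rewrite integral_cst// mul1e; exact: probability_setT.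
Qed.

Section strategy.
Variable z : R -> T -> R.
Hypothesis mz : progressively_measurable F t z.
Hypothesis z0 : forall r x, 0 <= r <= t -> 0 <= z r x.

Let K x := (\int[lebesgue_measure]_(v in `[0%R, t])
  (revenue B mu sigma alpha z v x)%:E)%E.

Let K_ge0 x : (0 <= K x)%E.
Proof.
apply: integral_ge0 => v; rewrite /= in_itv/= => vt.
by rewrite lee_fin revenue_ge0// z0.
Qed.

Let gain_ge0 x : (0 <= gain mt alpha (z ^~ x) t)%E.
Proof.
apply: integral_ge0 => v; rewrite /= in_itv/= => vt.
by rewrite lee_fin mulr_ge0 ?z0// mulr_ge0 ?expR_ge0// discount_ge0.
Qed.

Let mK : measurable_fun setT K.
Proof. exact: (measurable_integral_revenue filF bmB mu sigma alpha0 t01 mz z0). Qed.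

Let expected_revenue_le (c : R) : 0 <= c ->
  {ae P, forall x, (gain mt alpha (z ^~ x) t <= c%:E)%E} ->
  (\int[P]_x K x <= c%:E)%E.
Proof.
move=> c0 gc; rewrite /K (expected_gain filF bmB)//.
have -> : c%:E = (\int[P]_x ((density x)%:E * c%:E))%E.
  rewrite ge0_integralZr//= ?integral_density ?mul1e//.
  - exact/measurable_EFinP.
  - by move=> x _; rewrite lee_fin expR_ge0.
have mgain := measurable_gain filF mu sigma alpha0 t01 mz z0.
apply: ae_ge0_le_integral => //.
- by move=> x _; rewrite mule_ge0// lee_fin expR_ge0.
- by apply: emeasurable_funM => //; exact/measurable_EFinP.
- by move=> x _; rewrite mule_ge0// lee_fin expR_ge0.
- by apply: emeasurable_funM => //; exact/measurable_EFinP.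
- by apply: filterS gc => x gc _; rewrite lee_wpmul2l// lee_fin expR_ge0.
Qed.

Let expected_revenue (c : R) : 0 <= c ->
  (forall x, gain mt alpha (z ^~ x) t = c%:E) -> (\int[P]_x K x = c%:E)%E.
Proof.
move=> c0 gc; rewrite /K (expected_gain filF bmB)//.
under eq_integral do rewrite gc.
by rewrite ge0_integralZr//= ?integral_density ?mul1e//; exact/measurable_EFinP.
Qed.

Variables (w s : R).
Hypothesis s0 : 0 <= s.

Let cashE x : cash B mu sigma g w s z t x = w + s * fine (K x).
Proof.
rewrite /cash; congr (_ + _); rewrite -[s * _]/(fine s%:E * _).
have mrev := measurable_revenue filF bmB mu sigma alpha0 t01 mz x.
rewrite /Rintegral; under eq_integral => v _.
  rewrite /price fine_expeRB_discount// mulrCA EFinM; over.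
rewrite ge0_integralZl//=.
- by rewrite fine_mulEFin.
- exact/measurable_EFinP.
- by move=> v; rewrite /= in_itv/= => vt; rewrite lee_fin; apply: revenue_ge0; exact: z0.
Qed.

(** Cash is real-valued and so involves [fine (K x)]. A finite mean makes [K] finite almost surely,
    hence passing through [fine] leaves the expectation unchanged. *)
Let expectation_cashE : (\int[P]_x K x < +oo)%E ->
  ('E_P[cash B mu sigma g w s z t] = w%:E + s%:E * \int[P]_x K x)%E.
Proof.
move=> Koo.
have intK : P.-integrable setT K.
  apply/integrableP; split => //; under eq_integral do rewrite gee0_abs//.
  exact: Koo.
have Kae : ae_eq P setT K (EFin \o (fine \o K)).
  apply: filterS (integrable_ae measurableT intK) => x Kx _.
  by rewrite /= fineK// Kx.
have mfK : measurable_fun setT (EFin \o (fine \o K)).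
  by apply/measurable_EFinP; exact: measurableT_comp.
have EK : (\int[P]_x (fine (K x))%:E = \int[P]_x K x)%E.
  by apply: ae_eq_integral => //; exact: ae_eq_sym.
have intfK : P.-integrable setT (EFin \o (fine \o K)).
  apply/integrableP; split => //.
  by under eq_integral do rewrite gee0_abs ?lee_fin ?fine_ge0//; rewrite EK.
rewrite unlock; under eq_integral do rewrite cashE EFinD EFinM.
rewrite integralD//=.
- rewrite integralZl// EK; congr (_ + _)%E.
  by rewrite integral_cst// -[RHS]mule1; congr (_ * _)%E; exact: probability_setT.
- exact: finite_measure_integrable_cst.
- exact: integrableZl.
Qed.

Lemma expectation_cash_le (c : R) : 0 <= c ->
  {ae P, forall x, (gain mt alpha (z ^~ x) t <= c%:E)%E} ->
  ('E_P[cash B mu sigma g w s z t] <= (w + s * c)%:E)%E.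
Proof.
move=> c0 /(expected_revenue_le c0) Kc.
rewrite expectation_cashE; last exact: le_lt_trans Kc (ltry _).
by rewrite EFinD EFinM leeD2l// lee_wpmul2l.
Qed.

Lemma expectation_cash (c : R) : 0 <= c ->
  (forall x, gain mt alpha (z ^~ x) t = c%:E) ->
  ('E_P[cash B mu sigma g w s z t] = (w + s * c)%:E)%E.
Proof.
move=> c0 /(expected_revenue c0) Kc.
by rewrite expectation_cashE Kc ?ltry// EFinD EFinM.
Qed.

End strategy.
End expected_cash.

(** * Integrating a bounded flow discounted by its own past *)

Lemma bounded_integrable_itv (R : realType) (t M : R) (f : R -> R) :
  measurable_fun `[0, t] f -> (forall v, 0 <= v <= t -> `|f v| <= M) ->
  (@lebesgue_measure R).-integrable `[0, t] (EFin \o f).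
Proof.
move=> mf fM; apply: measurable_bounded_integrable => //=.
  by rewrite lebesgue_measure_itv/=; case: ifP; rewrite ?ltry// -EFinB ltry.
exists M; split; rewrite ?num_real// => y My v /=; rewrite in_itv/= => vt.
exact: le_trans (fM _ vt) (ltW My).
Qed.

Section discounted_flow.
Context {R : realType}.
Local Notation leb := (@lebesgue_measure R).
Variables (h : R -> R) (t M c : R).
Hypotheses (t0 : 0 <= t) (c0 : 0 < c).
Hypothesis mh : measurable_fun `[0, t] h.
Hypothesis h0M : forall v, 0 <= v <= t -> 0 <= h v <= M.

(** The section serves twice: with [h = f] and [c = 2 sqrt (alpha mt)] in the bound by shares, with
    [h = f^2] and [c = 2 alpha] in the bound by time. *)
Let H v := \int[leb]_(q in `[0, v]) h q.
Let e v := h v * expR (- (c * H v)).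
Let Phi v := \int[leb]_(q in `[0, v]) e q.

Let ih : leb.-integrable `[0, t] (EFin \o h).
Proof.
apply: (bounded_integrable_itv (M := M)) => // v /h0M /andP[h0 hM].
by rewrite ger0_norm.
Qed.

Let H_ge0 v : v <= t -> 0 <= H v.
Proof.
move=> vt; apply: Rintegral_ge0 => q /=; rewrite in_itv/= => /andP[q0 qv].
by have /andP[] : 0 <= h q <= M by rewrite h0M// q0 (le_trans qv).
Qed.

Let mH : measurable_fun `[0, t] H.
Proof.
apply: subspace_continuous_measurable_fun => //.
exact: parameterized_integral_continuous.
Qed.

Lemma measurable_discounted_flow : measurable_fun `[0, t] e.
Proof.
apply: measurable_funM => //; apply: (measurableT_comp (@measurable_expR R)).
by apply: measurableT_comp => //; exact: measurable_funM.
Qed.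

Lemma integrable_discounted_flow : leb.-integrable `[0, t] (EFin \o e).
Proof.
apply: (bounded_integrable_itv (M := M)); first exact: measurable_discounted_flow.
move=> v vt; have /andP[h0 hM] := h0M vt; have /andP[v0 v_t] := vt.
rewrite ger0_norm ?mulr_ge0 ?expR_ge0// (le_trans _ hM)// ler_piMr//.
by rewrite expR_le1 oppr_le0 mulr_ge0 ?H_ge0// ltW.
Qed.

Let itv_sub a b : 0 <= a -> b <= t -> `]a, b] `<=` `[0, t].
Proof.
move=> a0 bt q /=; rewrite !in_itv/= => /andP[aq qb].
by rewrite (le_trans a0 (ltW aq)) (le_trans qb).
Qed.

Let int_sub f a b : 0 <= a -> b <= t -> leb.-integrable `[0, t] (EFin \o f) ->
  leb.-integrable `]a, b] (EFin \o f).
Proof.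
move=> a0 bt; apply: integrableS; [exact: measurable_itv..|].
exact: itv_sub.
Qed.

Let itvB f a b : leb.-integrable `[0, t] (EFin \o f) ->
  0 <= a -> a <= b -> b <= t ->
  \int[leb]_(q in `[0, b]) f q =
  \int[leb]_(q in `[0, a]) f q + \int[leb]_(q in `]a, b]) f q.
Proof.
move=> fi a0 ab bt.
have fb : leb.-integrable `[0, b] (EFin \o f).
  apply: integrableS fi => //.
  by move=> q /=; rewrite !in_itv/= => /andP[-> /le_trans->].
by rewrite -(Rintegral_itvB fb (x := a)) ?bnd_simp// addrC subrK.
Qed.

Let H_incr a b : 0 <= a -> a <= b -> b <= t -> 0 <= H b - H a <= M * (b - a).
Proof.
move=> a0 ab bt; rewrite /H (itvB ih a0 ab bt) addrAC subrr add0r.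
have hq q : `]a, b]%classic q -> 0 <= h q <= M.
  by move/(itv_sub a0 bt); rewrite /= in_itv/= => /h0M.
rewrite Rintegral_ge0//=; last by move=> q /hq /andP[].
have -> : M * (b - a) = \int[leb]_(q in `]a, b]) M.
  rewrite Rintegral_cst//= lebesgue_measure_itv/= lte_fin.
  by move: ab; rewrite le_eqVlt => /predU1P[->|->//]; rewrite ltxx subrr.
apply: le_Rintegral => //=.
- exact: int_sub.
- apply: int_sub => //.
  exact: (bounded_integrable_itv (M := `|M|)).
- by move=> q /hq /andP[].
Qed.

(** As [H] is nondecreasing, freezing the discount at the left end [a] can only increase the
    integral. The factor in front is the price of comparing this left Riemann term with the exact
    increment of [- exp (- c H) / c]. *)
Let Phi_incr a b : 0 <= a -> a <= b -> b <= t ->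
  Phi b - Phi a <=
  expR (c * (M * (b - a))) * ((expR (- (c * H a)) - expR (- (c * H b))) / c).
Proof.
move=> a0 ab bt; have /andP[dH0 dHM] := H_incr a0 ab bt.
apply: (@le_trans _ _ ((H b - H a) * expR (- (c * H a)))).
  rewrite /Phi (itvB integrable_discounted_flow a0 ab bt) addrAC subrr add0r.
  have -> : (H b - H a) * expR (- (c * H a)) =
      \int[leb]_(q in `]a, b]) (h q * expR (- (c * H a))).
    rewrite RintegralZr//; last exact: int_sub.
    by rewrite /H (itvB ih a0 ab bt) addrAC subrr add0r.
  apply: le_Rintegral.
  - exact: measurable_itv.
  - exact/int_sub/integrable_discounted_flow.
  - rewrite (_ : _ \o _ = (fun q => (h q)%:E * (expR (- (c * H a)))%:E)%E)//.
    by apply: integrableZr => //; exact: int_sub.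
  - move=> q /=; rewrite in_itv/= => /andP[aq qb].
    have /andP[hq _] : 0 <= h q <= M.
      by rewrite h0M// (le_trans a0 (ltW aq)) (le_trans qb).
    have Haq : expR (- (c * H q)) <= expR (- (c * H a)).
      rewrite ler_expR lerN2 (ler_pM2l c0) -subr_ge0.
      by have /andP[] := H_incr a0 (ltW aq) (le_trans qb bt).
    exact: ler_wpM2l hq _ _ Haq.
set D := H b - H a in dH0 dHM *.
have -> : expR (- (c * H b)) = expR (- (c * H a)) * expR (- (c * D)).
  by rewrite -expRD; congr expR; rewrite /D; ring.
(* The right-hand side is [exp (c D) - 1]. *)
have e1 : c * D <= expR (c * D) * (1 - expR (- (c * D))).
  rewrite [leRHS]mulrBr mulr1 -expRD subrr expR0.
  by have := expR_ge1Dx (c * D); lra.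
have e2 : expR (c * D) <= expR (c * (M * (b - a))) by rewrite ler_expR ler_pM2l.
have e3 : 0 <= 1 - expR (- (c * D)).
  by rewrite subr_ge0 expR_le1 oppr_le0 mulr_ge0// ltW.
have e4 : c * D <= expR (c * (M * (b - a))) * (1 - expR (- (c * D))).
  exact: le_trans e1 (ler_wpM2r e3 e2).
have -> : expR (c * (M * (b - a))) *
   ((expR (- (c * H a)) - expR (- (c * H a)) * expR (- (c * D))) / c) =
   (expR (c * (M * (b - a))) * (1 - expR (- (c * D)))) / c * expR (- (c * H a)).
  by field; rewrite gt_eqF.
by rewrite ler_pM2r ?expR_gt0// ler_pdivlMr// mulrC.
Qed.

(* The integrand is the derivative of [- exp (- c H) / c] only almost everywhere;
   comparing both sides on a uniform partition of mesh [t / n] costs a factor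
   [exp (c M t / n)], which tends to 1. *)
Lemma discounted_flow_le :
  \int[leb]_(v in `[0, t]) e v <= (1 - expR (- (c * H t))) / c.
Proof.
have part n : Phi t <= expR (c * (M * (t / n.+1%:R))) * ((1 - expR (- (c * H t))) / c).
  pose x k : R := t * (k%:R / n.+1%:R).
  have x0 k : 0 <= x k by rewrite mulr_ge0// divr_ge0.
  have xt k : (k <= n.+1)%N -> x k <= t.
    by move=> kn; rewrite ler_piMr// ler_pdivrMr// mul1r ler_nat.
  have xS k : x k.+1 - x k = t / n.+1%:R.
    by rewrite /x -mulrBr -mulrBl -natr1 addrAC subrr add0r mul1r.
  have xn : x n.+1 = t by rewrite /x divff ?mulr1// pnatr_eq0.
  suff P k : (k <= n.+1)%N -> Phi (x k) <=
      expR (c * (M * (t / n.+1%:R))) * ((1 - expR (- (c * H (x k)))) / c).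
    by rewrite -{1 3}xn; exact: P.
  elim: k => [_|k IH kn].
    have -> : x 0%N = 0 by rewrite /x mul0r mulr0.
    by rewrite /Phi /H set_itv1 !Rintegral_set1 mulr0 oppr0 expR0 subrr mul0r mulr0.
  have xk : x k <= x k.+1 by rewrite -subr_ge0 xS divr_ge0.
  have := lerD (IH (ltnW kn)) (Phi_incr (x0 k) xk (xt _ kn)).
  rewrite addrC subrK xS => /le_trans; apply.
  move: (expR (- (c * H (x k.+1)))) (expR (- (c * H (x k)))) (expR _) => A' A p.
  by rewrite [leLHS](_ : _ = p * ((1 - A') / c))//; ring.
set y := (_ / c) in part *.
have cu : c * (M * (t / n.+1%:R)) @[n --> \oo] --> (0 : R).
  rewrite (_ : (fun n => _) = (fun n => c * M * t * harmonic n)); last first.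
    by apply/funext => n; rewrite !mulrA.
  rewrite -[X in _ --> X](mulr0 (c * M * t)); apply: cvgMr.
  exact: cvg_harmonic.
have ce : expR (c * (M * (t / n.+1%:R))) @[n --> \oo] --> (1 : R).
  by have := cvg_comp _ _ cu (@continuous_expR R 0); rewrite expR0.
have : expR (c * (M * (t / n.+1%:R))) * y @[n --> \oo] --> (y : R).
  by rewrite -[X in _ --> X]mul1r; apply: cvgMl.
move=> /cvgr_to_ge; apply; exact: nearW.
Qed.
End discounted_flow.

(** * Integrals with an explicit primitive *)

Lemma integral_is_derive (R : realType) (F f : R -> R) (a b : R) : a <= b ->
  (forall x, a <= x <= b -> is_derive x 1 F (f x)) ->
  (forall x, a <= x <= b -> {for x, continuous f}) ->
  (\int[lebesgue_measure]_(x in `[a, b]) (f x)%:E = (F b - F a)%:E)%E.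
Proof.
rewrite le_eqVlt => /predU1P[<- _ _|ab dF cf].
  by rewrite set_itv1 integral_set1 subrr.
have cF x : a <= x <= b -> {for x, continuous F}.
  move=> /dF dFx; apply: differentiable_continuous.
  by apply/derivable1_diffP.
rewrite (continuous_FTC2 (F := F) ab)//.
- apply/(continuous_within_itvP _ ab); split.
  + by move=> x; rewrite in_itv/= => /andP[ax xb]; apply: cf; rewrite !ltW.
  + by apply: cvg_at_right_filter; apply: cf; rewrite lexx ltW.
  + by apply: cvg_at_left_filter; apply: cf; rewrite lexx ltW.
- split.
  + by move=> x; rewrite in_itv/= => /andP[ax xb]; have [] := dF x; rewrite ?ltW.
  + by apply: cvg_at_right_filter; apply: cF; rewrite lexx ltW.
  + by apply: cvg_at_left_filter; apply: cF; rewrite lexx ltW.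
- move=> x; rewrite in_itv/= => /andP[ax xb]; rewrite derive1E.
  by have [|_ ->//] := dF x; rewrite !ltW.
Qed.

Lemma is_derive_expRM (R : realType) (b x : R) :
  is_derive x 1 (fun v => expR (b * v)) (b * expR (b * x)).
Proof.
have db : is_derive x 1 (fun v : R => b * v) b.
  by apply: is_derive_eq; rewrite /GRing.scale/= mulr1.
have := @is_derive1_comp R expR (fun v => b * v) x _ _ (is_derive_expR _) db.
by rewrite mulrC.
Qed.

Lemma integral_expRN (R : realType) (b t : R) : b != 0 -> 0 <= t ->
  (\int[lebesgue_measure]_(v in `[0%R, t]) (expR (- b * v))%:E =
   ((1 - expR (- b * t)) / b)%:E)%E.
Proof.
move=> b0 t0.
have dE x : 0 <= x <= t ->
    is_derive x 1 (fun v => (- b^-1) * expR (- b * v)) (expR (- b * x)).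
  move=> _; have dE := is_derive_expRM (- b) x.
  by apply: is_derive_eq; rewrite /GRing.scale/= mulrA mulrNN mulVf// mul1r.
have cE x : 0 <= x <= t -> {for x, continuous (fun v => expR (- b * v))}.
  move=> _; apply: continuous_comp; last exact: continuous_expR.
  exact: mulrl_continuous.
by rewrite (integral_is_derive t0 dE cE) mulr0 expR0; congr _%:E; field.
Qed.

(** * The two pathwise upper bounds *)

Section gain_upper_bounds.
Context {R : realType}.
Local Notation leb := (@lebesgue_measure R).
Variables (f : R -> R) (t M mt alpha : R).
Hypotheses (t0 : 0 < t) (mt0 : 0 < mt) (alpha0 : 0 < alpha).
Hypothesis mf : measurable_fun `[0, t] f.
Hypothesis f0M : forall v, 0 <= v <= t -> 0 <= f v <= M.

Let H v := \int[leb]_(q in `[0, v]) f q.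
Let A v := \int[leb]_(q in `[0, v]) (f q ^+ 2).

Let f2M v : 0 <= v <= t -> 0 <= f v ^+ 2 <= M ^+ 2.
Proof.
by move=> /f0M /andP[f0 fM]; rewrite sqr_ge0 ler_pXn2r// nnegrE (le_trans f0).
Qed.

Let mf2 : measurable_fun `[0, t] (fun v => f v ^+ 2).
Proof. exact: measurable_funX. Qed.

Let int_f : leb.-integrable `[0, t] (EFin \o f).
Proof.
apply: (bounded_integrable_itv (M := M)) => // v /f0M /andP[f0 fM].
by rewrite ger0_norm.
Qed.

Let int_f2 : leb.-integrable `[0, t] (EFin \o (fun v => f v ^+ 2)).
Proof.
apply: (bounded_integrable_itv (M := M ^+ 2)) => // v /f2M /andP[f0 fM].
by rewrite ger0_norm.
Qed.

Let itv_sub v : v <= t -> `[0, v] `<=` `[0, t].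
Proof. by move=> vt q /=; rewrite !in_itv/= => /andP[-> /le_trans->]. Qed.

Let int_sub k v : v <= t -> leb.-integrable `[0, t] (EFin \o k) ->
  leb.-integrable `[0, v] (EFin \o k).
Proof.
by move=> vt; apply: integrableS; [exact: measurable_itv..|exact: itv_sub].
Qed.

(** A bounded path has a finite cost, so the extended exponential is the ordinary one. *)
Lemma discountE v : v <= t -> discount alpha f v = expR (- (alpha * A v)).
Proof.
move=> vt; rewrite /discount -RintegralZl//; last exact: int_sub.
rewrite /Rintegral -[in LHS](@fineK _ (integral _ _ _))//.
apply: integrable_fin_num => //.
rewrite (_ : (fun q => _) = (fun q => alpha%:E * (f q ^+ 2)%:E)%E)//.
by apply: integrableZl => //; exact: int_sub.
Qed.

Let gain_le (k : R -> R) : measurable_fun `[0, t] k ->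
  (forall v, 0 <= v <= t ->
    f v * (expR (- mt * v) * expR (- (alpha * A v))) <= k v) ->
  (gain mt alpha f t <= \int[leb]_(v in `[0%R, t]) (k v)%:E)%E.
Proof.
move=> mk fk.
have fd v : 0 <= v <= t -> f v * (expR (- mt * v) * discount alpha f v) =
    f v * (expR (- mt * v) * expR (- (alpha * A v))).
  by move=> /andP[_ vt]; rewrite discountE.
rewrite /gain; under eq_integral => v.
  rewrite inE/= in_itv/= => /fd ->; over.
apply: ge0_le_integral => //.
- move=> v /=; rewrite in_itv/= => /f0M /andP[f0 _].
  by rewrite lee_fin !mulr_ge0// expR_ge0.
- apply/measurable_EFinP; apply: measurable_funM => //; apply: measurable_funM.
    apply: measurable_funTS; apply: (measurableT_comp (@measurable_expR R)).
    exact: mulrl_measurable.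
  apply: (measurableT_comp (@measurable_expR R)).
  apply: measurableT_comp => //; apply: measurable_funM => //.
  apply: subspace_continuous_measurable_fun => //.
  by apply: parameterized_integral_continuous => //; exact: ltW.
- exact/measurable_EFinP.
Qed.

Let int_cst (k v : R) : 0 <= v -> \int[leb]_(q in `[0, v]) k = k * v.
Proof.
rewrite Rintegral_cst//= lebesgue_measure_itv/= lte_fin le_eqVlt => /predU1P[<-|->].
  by rewrite ltxx.
by rewrite -EFinB subr0.
Qed.

(* [mt + alpha f^2 >= 2 sqrt (alpha mt) f], so the exponent of the discounted
   price dominates the number of shares already sold. *)
Lemma gain_le_shares (phi : R) : H t <= phi ->
  (gain mt alpha f t <=
   ((1 - expR (- 2 * Num.sqrt (alpha * mt) * phi)) / (2 * Num.sqrt (alpha * mt)))%:E)%E.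
Proof.
move=> Hphi; set a := Num.sqrt (alpha * mt).
have a0 : 0 < 2 * a by rewrite mulr_gt0// sqrtr_gt0 mulr_gt0.
have a2 : a ^+ 2 = alpha * mt by rewrite sqr_sqrtr// ltW// mulr_gt0.
pose k v := f v * expR (- (2 * a * H v)).
(* Expansion of the square of [sqrt mt - sqrt alpha y], which vanishes exactly at the speed of
   [zeta2_hat]. *)
have amgm y : 2 * a * y <= mt + alpha * y ^+ 2.
  have p2 : Num.sqrt alpha ^+ 2 = alpha by rewrite sqr_sqrtr// ltW.
  have q2 : Num.sqrt mt ^+ 2 = mt by rewrite sqr_sqrtr// ltW.
  have apq : a = Num.sqrt alpha * Num.sqrt mt by rewrite /a sqrtrM// ltW.
  have h := sqr_ge0 (Num.sqrt mt - Num.sqrt alpha * y).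
  rewrite sqrrB exprMn p2 q2 in h; rewrite apq -subr_ge0.
  by rewrite [leRHS](_ : _ = mt - (Num.sqrt mt * (Num.sqrt alpha * y)) *+ 2 +
    alpha * y ^+ 2)//; ring.
have fk v : 0 <= v <= t ->
    f v * (expR (- mt * v) * expR (- (alpha * A v))) <= k v.
  move=> v0t; have /andP[v0 vt] := v0t; have /andP[f0 _] := f0M v0t.
  have HA : 2 * a * H v <= mt * v + alpha * A v.
    have iaf : leb.-integrable `[0, v] (EFin \o (fun q => alpha * f q ^+ 2)).
      rewrite (_ : _ \o _ = (fun q => alpha%:E * (f q ^+ 2)%:E)%E)//.
      by apply: integrableZl => //; exact: int_sub.
    have imt : leb.-integrable `[0, v] (EFin \o (fun=> mt)).
      by apply: (bounded_integrable_itv (M := `|mt|)).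
    rewrite -(int_cst mt v0) -RintegralZl//; last exact: int_sub.
    rewrite -RintegralZl//; last exact: int_sub.
    rewrite -RintegralD//; apply: le_Rintegral.
    - exact: measurable_itv.
    - rewrite (_ : _ \o _ = (fun q => (2 * a)%:E * (f q)%:E)%E)//.
      by apply: integrableZl => //; exact: int_sub.
    - rewrite (_ : _ \o _ = (fun q => mt%:E + (alpha * f q ^+ 2)%:E)%E)//.
      exact: integrableD.
    - by move=> q _; exact: amgm.
  have ek : expR (- mt * v) * expR (- (alpha * A v)) <= expR (- (2 * a * H v)).
    by rewrite -expRD ler_expR mulNr -opprD lerN2.
  exact: ler_wpM2l f0 _ _ ek.
apply: (le_trans (gain_le _ fk)).
  exact: (@measurable_discounted_flow _ f t M (2 * a) (ltW t0) mf f0M).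
have ik := @integrable_discounted_flow _ f t M (2 * a) (ltW t0) a0 mf f0M.
rewrite -[X in (X <= _)%E]fineK; last exact: integrable_fin_num.
have le1 := @discounted_flow_le _ f t M (2 * a) (ltW t0) a0 mf f0M.
rewrite lee_fin; apply: (le_trans le1).
rewrite ler_pM2r ?invr_gt0// lerD2l lerN2 ler_expR !mulNr lerN2.
by rewrite ler_pM2l.
Qed.

(* Cauchy-Schwarz on the factors [exp (- mt v)] and [f exp (- alpha A)], in the
   form of AM-GM with the optimal weight [k]. *)
Lemma gain_le_time :
  (gain mt alpha f t <=
   (Num.sqrt (1 - expR (- 2 * mt * t)) / (2 * Num.sqrt (alpha * mt)))%:E)%E.
Proof.
set r := Num.sqrt _; set a := Num.sqrt (alpha * mt).
have e1 : expR (- 2 * mt * t) < 1.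
  by rewrite expR_lt1 -mulrA mulNr oppr_lt0 !mulr_gt0.
have r0 : 0 < r by rewrite sqrtr_gt0 subr_gt0.
have r2 : r ^+ 2 = 1 - expR (- 2 * mt * t) by rewrite sqr_sqrtr// subr_ge0 ltW.
have a0 : 0 < a by rewrite sqrtr_gt0 mulr_gt0.
have a2 : a ^+ 2 = alpha * mt by rewrite sqr_sqrtr// ltW// mulr_gt0.
(* The weight minimises [k I / 2 + J / (2 k)], where [I = r^2 / (2 mt)] is the integral of
   [exp (- 2 mt v)] and [J = 1 / (2 alpha)] bounds that of [G]. Both terms then equal
   [r / (4 a)]. *)
pose k := mt / (a * r).
have k0 : 0 < k by rewrite divr_gt0// mulr_gt0.
pose G v := f v ^+ 2 * expR (- (2 * alpha * A v)).
have fk v : 0 <= v <= t -> f v * (expR (- mt * v) * expR (- (alpha * A v))) <=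
    k / 2 * expR (- (2 * mt) * v) + (2 * k)^-1 * G v.
  move=> _; rewrite /G.
  have -> : expR (- (2 * mt) * v) = expR (- mt * v) ^+ 2.
    by rewrite expr2 -expRD; congr expR; ring.
  have -> : expR (- (2 * alpha * A v)) = expR (- (alpha * A v)) ^+ 2.
    by rewrite expr2 -expRD; congr expR; ring.
  move: (expR (- mt * v)) (expR (- (alpha * A v))) (f v) => x y z.
  rewrite -subr_ge0 (_ : _ - _ = (k * x - z * y) ^+ 2 / (2 * k)).
    by rewrite divr_ge0 ?sqr_ge0// mulr_ge0// ltW.
  by field; rewrite gt_eqF.
have a20 : 0 < 2 * alpha by rewrite mulr_gt0.
have mG := @measurable_discounted_flow _ _ t _ (2 * alpha) (ltW t0) mf2 f2M.
have iG := @integrable_discounted_flow _ _ t _ (2 * alpha) (ltW t0) a20 mf2 f2M.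
have leG := @discounted_flow_le _ _ t _ (2 * alpha) (ltW t0) a20 mf2 f2M.
have mE : measurable_fun `[0, t] (fun v => expR (- (2 * mt) * v)).
  apply: measurable_funTS; apply: (measurableT_comp (@measurable_expR R)).
  exact: mulrl_measurable.
apply: (le_trans (gain_le _ fk)).
  by apply: measurable_funD; exact: measurable_funM.
have G0 v : 0 <= G v by rewrite mulr_ge0 ?sqr_ge0 ?expR_ge0.
have k20 : 0 <= (2 * k)^-1 by rewrite invr_ge0 mulr_ge0// ltW.
rewrite (_ : integral _ _ _ = (k / 2)%:E *
    \int[leb]_(v in `[0%R, t]) (expR (- (2 * mt) * v))%:E +
    ((2 * k)^-1)%:E * \int[leb]_(v in `[0%R, t]) (G v)%:E)%E; last first.
  rewrite -!ge0_integralZl//.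
  - rewrite -ge0_integralD//.
    + move=> v _; rewrite lee_fin mulr_ge0 ?expR_ge0// divr_ge0// ltW//.
    + by apply/measurable_EFinP; exact: measurable_funM.
    + by move=> v _; rewrite lee_fin mulr_ge0.
    + by apply/measurable_EFinP; exact: measurable_funM.
  - exact/measurable_EFinP.
  - by move=> v _; rewrite lee_fin.
  - exact/measurable_EFinP.
  - by rewrite lee_fin divr_ge0 ?ltW.
rewrite integral_expRN ?(ltW t0)//; last by rewrite gt_eqF ?mulr_gt0.
rewrite -(fineK (integrable_fin_num _ iG))// -!EFinM -EFinD lee_fin.
(* The term [exp (- 2 alpha A t)] is dropped. It is positive whenever the cost is finite, so bounded
   paths stay strictly below the bound. *)
have leG' : (2 * k)^-1 * fine (\int[leb]_(v in `[0%R, t]) (G v)%:E) <=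
    (2 * k)^-1 * (2 * alpha)^-1.
  apply: ler_wpM2l k20 _ _ _.
  apply: (@le_trans _ _ _ _ _ leG).
  by rewrite ler_pdivrMr// mulVf ?gt_eqF// lerBlDr lerDl expR_ge0.
apply: (le_trans (lerD (lexx _) leG')).
rewrite -(mulNr 2) -r2 /k [leLHS](_ : _ = r / (2 * a))//.
have -> : alpha = a ^+ 2 / mt by rewrite a2 mulfK// gt_eqF.
by field; rewrite !gt_eqF.
Qed.

End gain_upper_bounds.

(** * Gains and share counts of the two explicit strategies *)

Section explicit_gains.
Context {R : realType}.
Local Notation leb := (@lebesgue_measure R).
Variables (mt alpha : R).
Hypotheses (mt0 : 0 < mt) (alpha0 : 0 < alpha).

Let a := Num.sqrt (alpha * mt).
Let a_gt0 : 0 < a. Proof. by rewrite sqrtr_gt0 mulr_gt0. Qed.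
Let a2 : a ^+ 2 = alpha * mt. Proof. by rewrite sqr_sqrtr// ltW// mulr_gt0. Qed.

(** Expressing all radicals through [a] leaves rational identities modulo [a ^+ 2 = alpha * mt]. *)
Let sqrt_ratio : Num.sqrt (mt / alpha) = mt / a.
Proof.
have -> : mt / alpha = (mt / a) ^+ 2.
  by rewrite expr_div_n a2; field; rewrite !gt_eqF.
by rewrite sqrtr_sqr ger0_norm// divr_ge0// ltW.
Qed.

Let sqrt_ratioV : Num.sqrt (alpha / mt) = a / mt.
Proof.
have -> : alpha / mt = (a / mt) ^+ 2.
  by rewrite expr_div_n a2; field; rewrite !gt_eqF.
by rewrite sqrtr_sqr ger0_norm// divr_ge0// ltW.
Qed.

(* [zeta1_hat] is unbounded near [t], hence not admissible; its truncations are
   admissible and their gains converge to the supremum. *)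
Definition truncated (f : R -> R) (tau v : R) : R := f v * \1_(`[0, tau]) v.

Let truncatedE f tau v : 0 <= v <= tau -> truncated f tau v = f v.
Proof. by move=> vt; rewrite /truncated indicE mem_set ?mulr1//= in_itv. Qed.

Let truncated0 f tau v : ~~ (0 <= v <= tau) -> truncated f tau v = 0.
Proof.
move=> vt; rewrite /truncated indicE memNset ?mulr0//= in_itv/=.
exact/negP.
Qed.

(** For both strategies the discounted flow is proportional to [exp (- 2 mt v)] while selling lasts.
    The time [v = tau] is excluded because [zeta1_hat] takes the value 0 at [t]; a single point does
    not affect the integral. *)
Lemma gain_truncated (f : R -> R) (c tau t : R) : 0 <= tau -> tau <= t ->
  (forall v, 0 <= v < tau ->
    f v * (expR (- mt * v) * discount alpha f v) = c * expR (- (2 * mt) * v)) ->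
  gain mt alpha (truncated f tau) t = (c * ((1 - expR (- (2 * mt) * tau)) / (2 * mt)))%:E.
Proof.
move=> tau0 taut fE; rewrite /gain.
pose h v := truncated f tau v * (expR (- mt * v) * discount alpha (truncated f tau) v).
have -> : (\int[leb]_(v in `[0%R, t]) (h v)%:E = \int[leb]_(v in `[0%R, tau]) (h v)%:E)%E.
  rewrite [LHS]integral_mkcond [RHS]integral_mkcond.
  apply: eq_integral => v _; rewrite !patchE.
  have [vtau|vtau] := boolP (0 <= v <= tau).
    rewrite !mem_set//= in_itv//=; have /andP[-> vt] := vtau.
    exact: le_trans vt taut.
  by rewrite /h truncated0// mul0r !if_same.
have mc : measurable_fun `]0, tau[ (fun v => c * expR (- (2 * mt) * v)).
  apply: measurable_funTS; apply: measurable_funM => //.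
  apply: (measurableT_comp (@measurable_expR R)); exact: mulrl_measurable.
have hE : {in `]0, tau[, h =1 (fun v => c * expR (- (2 * mt) * v))}.
  move=> v; rewrite in_itv/= => /andP[v0 vtau].
  rewrite -fE ?(ltW v0)// /h truncatedE ?ltW//; congr (_ * (_ * _)).
  apply: eq_discount => q /andP[q0 qv]; rewrite truncatedE// q0/=.
  exact: le_trans qv (ltW vtau).
rewrite (eq_integral_itv_bounded _ _ _ mc)//; last first.
  apply: eq_measurable_fun mc => v; rewrite inE => vt; apply/esym/hE; exact: vt.
under eq_integral do rewrite EFinM.
rewrite integralZl//; last first.
  apply: continuous_compact_integrable; first exact: segment_compact.
  apply: continuous_subspaceT => v; apply: continuous_comp; last exact: continuous_expR.
  exact: mulrl_continuous.
by rewrite integral_expRN// ?gt_eqF ?mulr_gt0.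
Qed.

Lemma zeta2_truncated phi :
  zeta2_hat mt alpha phi = truncated (cst (Num.sqrt (mt / alpha))) (phi * (a / mt)).
Proof. by rewrite /zeta2_hat sqrt_ratioV. Qed.

Lemma gain_zeta2 (phi t : R) : 0 <= phi -> phi <= Phi2_hat mt alpha t ->
  gain mt alpha (zeta2_hat mt alpha phi) t =
  ((1 - expR (- 2 * a * phi)) / (2 * a))%:E.
Proof.
rewrite /Phi2_hat sqrt_ratio => phi0 phit.
rewrite zeta2_truncated sqrt_ratio (@gain_truncated _ (mt / a)).
- congr _%:E; rewrite (_ : - (2 * mt) * (phi * (a / mt)) = - 2 * a * phi).
    by field; rewrite !gt_eqF.
  by field; rewrite !gt_eqF.
- by rewrite mulr_ge0// divr_ge0// ltW.
(* The hypothesis [phi <= Phi2_hat] read as a time: at this speed the sale ends by [t]. *)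
- rewrite [leRHS](_ : t = mt / a * t * (a / mt)); last first.
    by field; rewrite !gt_eqF.
  by rewrite ler_pM2r// divr_gt0.
- move=> v /andP[v0 _]; rewrite /cst; congr (_ * _).
  (* Here [alpha zeta^2 = mt]: the impact lowers the price at the same rate as the drift. *)
  suff -> : discount alpha (fun=> mt / a) v = expR (- mt * v).
    by rewrite -expRD; congr expR; ring.
  rewrite /discount (_ : (fun q => _) = (fun=> mt%:E)); last first.
    by apply/funext => q; rewrite expr_div_n a2; congr _%:E; field; rewrite !gt_eqF.
  rewrite integral_cst//= lebesgue_measure_itv/= lte_fin.
  move: v0; rewrite le_eqVlt => /predU1P[<-|->].
    by rewrite ltxx mule0 oppe0 /= mulr0.
  by rewrite -EFinB subr0 -EFinM -EFinN /= mulNr.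
Qed.

Section zeta1.
Variable t : R.
Hypothesis t0 : 0 < t.

(** The strategy is [mt / a] divided by [sqrt u], and [u] solves the autonomous equation
    [u' = - 2 mt (1 - u)]; this makes the primitives below explicit. *)
Let u (q : R) : R := 1 - expR (- 2 * mt * (t - q)).

Let du (q : R) : is_derive q (1 : R) (u : R -> R) (- (2 * mt * (1 - u q))).
Proof.
have dl : is_derive q 1 (fun q : R => - 2 * mt * (t - q)) (2 * mt).
  by apply: is_derive_eq; rewrite /GRing.scale/=; ring.
have dE := @is_derive1_comp R (@expR R) _ q _ _ (is_derive_expR _) dl.
have h : is_derive q 1 u (0 - expR (- 2 * mt * (t - q)) * (2 * mt)).
  exact: is_deriveB (is_derive_cst (1 : R) q 1) dE.
by apply: is_derive_eq; rewrite /u; ring.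
Qed.

Let u_gt0 q : q < t -> 0 < u q.
Proof.
by move=> qt; rewrite subr_gt0 expR_lt1 -mulrA mulNr oppr_lt0 !mulr_gt0// subr_gt0.
Qed.

Let sqrt_u q : 0 < u q -> Num.sqrt (u q) = expR (ln (u q) / 2).
Proof.
move=> uq; rewrite -{1}(lnK (uq : u q \is Num.pos)).
rewrite (_ : expR (ln _) = expR (ln (u q) / 2) ^+ 2).
  by rewrite sqrtr_sqr ger0_norm ?expR_ge0.
by rewrite expr2 -expRD -splitr.
Qed.

Let cu (q : R) : {for q, continuous u}.
Proof.
apply: differentiable_continuous; apply/derivable1_diffP.
by have [] := du q.
Qed.

(** Valid for every [q]: from [t] on, [u q] is nonpositive and both sides are 0 by the conventions
    for roots and inverses. *)
Let zeta1E q : zeta1_hat mt alpha t q = mt / a / Num.sqrt (u q).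
Proof.
rewrite /zeta1_hat -/(u q) invfM mulrA sqrtrM; last by rewrite divr_ge0 ?ltW.
rewrite sqrt_ratio; have [u0|/ltW u0] := leP 0 (u q); first by rewrite sqrtrV.
by rewrite !ler0_sqrtr ?invr_le0// invr0.
Qed.

Lemma zeta1_ge0 q : 0 <= zeta1_hat mt alpha t q.
Proof. exact: sqrtr_ge0. Qed.

Let discount_zeta1 v : 0 <= v < t ->
  discount alpha (zeta1_hat mt alpha t) v =
  expR (- mt * v) * Num.sqrt (u v) / Num.sqrt (u 0).
Proof.
move=> /andP[v0 vt].
have ut q : 0 <= q <= v -> 0 < u q.
  by move=> /andP[_ qv]; apply: u_gt0; exact: le_lt_trans qv vt.
(* A primitive of [alpha zeta^2 = mt / u], since [- u' / (2 u) = mt / u - mt]. *)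
pose G q := mt * q - ln (u q) / 2.
have dG q : 0 <= q <= v -> is_derive q 1 G (mt / u q).
  move=> /ut uq.
  have dln := @is_derive1_comp R (@ln R) u q _ _ (is_derive1_ln uq) (du q).
  have dlin : is_derive q 1 (fun q : R => mt * q) mt.
    by apply: is_derive_eq; rewrite /GRing.scale/= mulr1.
  have h := is_deriveB dlin (is_deriveZ 2^-1 dln).
  rewrite (_ : G = (fun q => mt * q) - 2^-1 \*: (@ln R \o u)).
    by apply: is_derive_eq; rewrite /GRing.scale/=; field; rewrite gt_eqF.
  by apply/funext => x; rewrite /G [_ / 2]mulrC.
have cG q : 0 <= q <= v -> {for q, continuous (fun q => mt / u q)}.
  move=> /ut uq; apply: cvgM; first exact: cvg_cst.
  by apply: cvgV; [rewrite gt_eqF|exact: cu].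
have sqrt_u' q : 0 <= q <= v -> Num.sqrt (u q) = expR (ln (u q) / 2).
  by move=> /ut; exact: sqrt_u.
rewrite /discount; under eq_integral => q.
  rewrite inE/= in_itv/= => qv.
  rewrite zeta1E !expr_div_n a2 sqr_sqrtr; last exact/ltW/ut.
  rewrite (_ : alpha * _ = mt / u q); last by field; rewrite !gt_eqF// ut.
  over.
rewrite (integral_is_derive v0 dG cG) -EFinN /=.
rewrite !sqrt_u' ?lexx ?v0//= -expRN -!expRD; congr expR.
by rewrite /G; field.
Qed.

(** The factor [sqrt (u v)] of the discount cancels the one in the denominator of [zeta1_hat], which
    leaves a constant times [exp (- 2 mt v)]. *)
Lemma gain_zeta1 tau : 0 <= tau -> tau <= t ->
  gain mt alpha (truncated (zeta1_hat mt alpha t) tau) t =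
  ((1 - expR (- (2 * mt) * tau)) / (2 * a * Num.sqrt (u 0)))%:E.
Proof.
move=> tau0 taut; rewrite (gain_truncated (c := mt / a / Num.sqrt (u 0)))//.
  congr _%:E; field; rewrite !gt_eqF// sqrtr_gt0; exact: u_gt0.
move=> v /andP[v0 vtau]; have vt := lt_le_trans vtau taut.
rewrite discount_zeta1 ?v0// zeta1E.
rewrite (_ : expR (- (2 * mt) * v) = expR (- mt * v) ^+ 2); last first.
  by rewrite expr2 -expRD; congr expR; ring.
by field; rewrite !gt_eqF// sqrtr_gt0; exact: u_gt0.
Qed.

(* For [y = sqrt (1 - exp (- 2 mt t))], [(1 - y) (1 + y) = exp (- 2 mt t)], so
   [arctanh y = ln (1 + y) + mt t]. *)
Let Phi1E : Phi1_hat mt alpha t = (ln (1 + Num.sqrt (u 0)) + mt * t) / a.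
Proof.
rewrite /Phi1_hat -/a; congr (_ / _).
rewrite (_ : 1 - _ = u 0); last by rewrite /u subr0.
rewrite /arctanh; set y := Num.sqrt (u 0).
have y0 : 0 <= y by exact: sqrtr_ge0.
have y2 : y ^+ 2 = u 0 by rewrite sqr_sqrtr// ltW// u_gt0.
have E2 : (1 - y) * (1 + y) = expR (- (2 * mt * t)).
  rewrite (_ : _ * _ = 1 - y ^+ 2); last by ring.
  by rewrite y2 /u subr0 opprB addrC subrK; congr expR; ring.
have y1 : 0 < 1 + y by rewrite ltr_wpDr.
have y1' : 1 - y != 0.
  apply/eqP => yy; have := expR_gt0 (- (2 * mt * t)).
  by rewrite -E2 yy mul0r ltxx.
rewrite (_ : (1 + y) / (1 - y) = (1 + y) ^+ 2 * expR (2 * mt * t)).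
  rewrite lnM ?posrE ?exprn_gt0 ?expR_gt0// expRK lnXn// -mulr_natl.
  by field.
have -> : expR (2 * mt * t) = ((1 - y) * (1 + y))^-1 by rewrite E2 -expRN opprK.
by field; rewrite y1' gt_eqF.
Qed.

(** The primitive [G q] is minus [Phi1_hat] evaluated at the remaining time [t - q], that is, minus
    the shares still to be sold after [q]. It is nonpositive at [tau], and at 0 it equals minus the
    claimed bound. *)
Let integral_zeta1_lt tau : 0 <= tau < t ->
  (\int[leb]_(q in `[0%R, tau]) (zeta1_hat mt alpha t q)%:E <=
   (Phi1_hat mt alpha t)%:E)%E.
Proof.
move=> /andP[tau0 taut].
have ut q : 0 <= q <= tau -> 0 < u q.
  by move=> /andP[_ qv]; apply: u_gt0; exact: le_lt_trans qv taut.
pose G q := - a^-1 * (ln (1 + Num.sqrt (u q)) + mt * (t - q)).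
pose z q := mt / a / Num.sqrt (u q).
have dG q : 0 <= q <= tau -> is_derive q 1 G (z q).
  move=> /ut uq.
  have su : 0 < Num.sqrt (u q) by rewrite sqrtr_gt0.
  have su1 : 0 < 1 + Num.sqrt (u q) by rewrite addr_gt0.
  have ds := @is_derive1_comp R (@Num.sqrt R) u q _ _ (is_derive1_sqrt uq) (du q).
  have ds1 := is_deriveD (is_derive_cst (1 : R) q 1) ds.
  have dln := @is_derive1_comp R (@ln R) _ q _ _ (is_derive1_ln su1) ds1.
  have dlin : is_derive q 1 (fun q : R => mt * (t - q)) (- mt).
    by apply: is_derive_eq; rewrite /GRing.scale/=; ring.
  have h : is_derive q 1 G _ := is_deriveZ (- a^-1) (is_deriveD dln dlin).
  apply: is_derive_eq; rewrite /GRing.scale/= /z.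
  have : u q = Num.sqrt (u q) ^+ 2 by rewrite sqr_sqrtr// ltW.
  move: su su1; set y := Num.sqrt (u q) => su su1 ->.
  by field; rewrite !gt_eqF.
have cz q : 0 <= q <= tau -> {for q, continuous z}.
  move=> /ut uq; apply: cvgM; first exact: cvg_cst.
  apply: cvgV; first by rewrite gt_eqF// sqrtr_gt0.
  exact: continuous_comp (@cu q) (@sqrt_continuous _ _).
under eq_integral do rewrite zeta1E.
rewrite (integral_is_derive tau0 dG cz) lee_fin Phi1E /G subr0.
have G0 : 0 <= ln (1 + Num.sqrt (u tau)) + mt * (t - tau).
  rewrite addr_ge0// ?ln_ge0 ?lerDl ?sqrtr_ge0//.
  by rewrite mulr_ge0 ?subr_ge0 ?ltW.
rewrite !mulNr opprK addrC [leRHS]mulrC lerBlDr lerDl.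
by rewrite mulr_ge0// invr_ge0 ltW.
Qed.

Lemma measurable_zeta1 D : measurable_fun D (zeta1_hat mt alpha t).
Proof.
have mu : measurable_fun setT u.
  by apply: continuous_measurable_fun => q; exact: cu.
apply: measurable_funTS; rewrite (_ : zeta1_hat _ _ _ =
    (fun q => if q < t then mt / a * expR (- (2^-1 * ln (u q))) else 0)).
  apply: measurable_fun_ifT => //; first exact: measurable_fun_ltr.
  apply: measurable_funM => //; apply: (measurableT_comp (@measurable_expR R)).
  apply: measurableT_comp => //; apply: measurable_funM => //.
  exact: (measurableT_comp (@measurable_ln R)).
apply/funext => q; rewrite zeta1E; case: ltP => qt.
  by rewrite sqrt_u ?u_gt0// -expRN [_ / 2]mulrC.
rewrite ler0_sqrtr ?invr0 ?mulr0// subr_le0 -[leLHS](@expR0 R) ler_expR.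
rewrite -mulrA mulNr -!mulrN opprB.
by rewrite mulr_ge0// mulr_ge0 ?subr_ge0 ?(ltW mt0).
Qed.

(** The primitive is differentiated only before [t], where [sqrt u] is positive; monotone
    convergence along [[0, t (1 - 1 / (n + 1))]] carries the bound to the singular endpoint. *)
Lemma integral_zeta1 :
  (\int[leb]_(q in `[0%R, t]) (zeta1_hat mt alpha t q)%:E <=
   (Phi1_hat mt alpha t)%:E)%E.
Proof.
have mz (D : set (measurableTypeR R)) :
    measurable_fun D (EFin \o zeta1_hat mt alpha t : measurableTypeR R -> \bar R).
  by apply/measurable_EFinP; exact: measurable_zeta1.
rewrite -integral_itv_bndo_bndc; last exact: mz.
pose I n := `[0, t * (1 - n.+1%:R^-1)]%classic : set (measurableTypeR R).
have n1 n : n.+1%:R^-1 <= 1 :> R by rewrite invf_le1// ler1n.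
have n0 n : 0 < n.+1%:R^-1 :> R by rewrite invr_gt0.
have -> : `[0, t[%classic = \bigcup_n I n.
  apply/seteqP; split => q /=.
    rewrite in_itv/= => /andP[q0 qt].
    have tq : 0 < (t - q) / t by rewrite divr_gt0// subr_gt0.
    have [n nq] := ltr_add_invr tq.
    exists n => //; rewrite /I/= in_itv/= q0/=.
    rewrite add0r ltr_pdivlMr// in nq.
    by rewrite mulrBr mulr1 lerBrDr -lerBrDl mulrC ltW.
  move=> [n _]; rewrite /I/= !in_itv/= => /andP[-> /le_lt_trans]; apply.
  by rewrite gtr_pMr// gtrBl.
have ndI : nondecreasing_seq I.
  move=> m n mn; apply/subsetPset => q; rewrite /I/= !in_itv/= => /andP[-> /le_trans].
  apply; rewrite ler_pM2l// lerD2l lerN2 lef_pV2 ?posrE// ler_nat//.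
have := @ge0_nondecreasing_set_cvg_integral _ _ R I
  (EFin \o zeta1_hat mt alpha t) leb ndI.
move=> /(_ (fun n => measurable_itv _) (fun n => mz _)).
move=> /(_ (fun n q _ => zeta1_ge0 q)) cI.
apply: (cvge_to_le cI).
apply: nearW => n; apply: integral_zeta1_lt.
by rewrite mulr_ge0 ?subr_ge0 ?(ltW t0)//= gtr_pMr// gtrBl.
Qed.

(** Monotonicity before [t] makes the value at [w] a bound on [[0, w]]; both notions of
    admissibility get their bounds in this way. *)
Lemma zeta1_le v w : v <= w -> w < t ->
  zeta1_hat mt alpha t v <= zeta1_hat mt alpha t w.
Proof.
move=> vw wt; rewrite !zeta1E ler_pM2l ?divr_gt0//.
have u0 q : q < t -> 0 < Num.sqrt (u q) by move=> qt; rewrite sqrtr_gt0 u_gt0.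
have vt : v < t := le_lt_trans vw wt.
rewrite lef_pV2 ?posrE ?u0// ler_wsqrtr// lerD2l lerN2 ler_expR !mulNr lerN2.
by rewrite ler_pM2l ?mulr_gt0// lerD2l lerN2.
Qed.

End zeta1.

End explicit_gains.

(** * Bounds on the value function and admissibility *)

Section strategies.
Context {d : measure_display} {T : measurableType d} {R : realType}.
Local Notation leb := (@lebesgue_measure R).
Variables (P : probability T R) (F : R -> set (set T)).
Implicit Types (f g : R -> R) (t phi : R).

Lemma eq_gain (mt alpha t : R) f g : (forall v, 0 <= v <= t -> f v = g v) ->
  gain mt alpha f t = gain mt alpha g t.
Proof.
move=> fg; apply: eq_integral => v; rewrite inE/= in_itv/= => vt.
have /andP[v0 v_t] := vt; rewrite fg//; congr (_ * (_ * _))%:E.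
by apply: eq_discount => q /andP[q0 qv]; rewrite fg// q0 (le_trans qv).
Qed.

Lemma progressively_measurable_deterministic t f :
  measurable_fun setT f -> progressively_measurable F t (fun r (_ : T) => f r).
Proof.
move=> mf r _; apply: measurable_funTS.
by move=> _ U mU; exact: (measurableT_comp mf measurable_fst).
Qed.

Lemma adapted_deterministic t f : filtration F -> t <= 1 ->
  adapted F t (fun r (_ : T) => f r).
Proof.
move=> [sF _ _] t1 r /andP[r0 rt] U _.
have [F0 FC _] : sigma_algebra setT (F r) by apply: sF; rewrite r0 (le_trans rt).
have [Ufr|Ufr] := pselect (U (f r)).
  by rewrite (_ : _ @^-1` U = setT `\` set0); [exact: FC|rewrite setD0; apply/seteqP; split].
by rewrite (_ : _ @^-1` U = set0)//; apply/seteqP; split.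
Qed.

Lemma progressively_measurable_path t z x : 0 <= t ->
  progressively_measurable F t z -> measurable_fun `[0, t] (z ^~ x : R -> R).
Proof.
move=> t0 mz; have tt : 0 <= t <= t by rewrite t0 lexx.
have mp : measurable_fun (`[0, t] : set (measurableTypeR R))
    (fun v => (v, x) : (measurableTypeR R * g_sigma_algebraType (F t))%type).
  exact/measurable_funTS/measurable_pair2.
have mS : measurable [set p : (measurableTypeR R * g_sigma_algebraType (F t))%type
    | 0 <= p.1 <= t].
  rewrite (_ : mkset _ = `[0, t]%classic `*` setT); first exact: measurableX.
  by apply/seteqP; split => p /=; rewrite in_itv/= => //; tauto.
have h := measurable_comp mS _ (mz t tt) mp.
move=> mI U mU; apply: h => //.
by move=> p [v /=]; rewrite in_itv/= => vt <-.
Qed.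

Lemma measurable_truncated f tau : measurable_fun setT f ->
  measurable_fun setT (truncated f tau).
Proof.
by move=> mf; apply: measurable_funM => //; exact: measurable_indic.
Qed.

Section value.
Variables (B : R -> T -> R) (mu sigma alpha w s t phi : R).
Hypotheses (filF : filtration F) (bmB : standard_brownian_motion P F B).
Hypotheses (alpha0 : 0 < alpha) (t01 : 0 < t <= 1) (s0 : 0 <= s).
Let mt := mu - sigma ^+ 2 / 2.
Let g := fun y : R => alpha * y ^+ 2.
Hypothesis mt0 : 0 < mt.

Lemma value_le (c : R) : 0 <= c ->
  (forall z, admissible P F t phi z ->
    {ae P, forall x, (gain mt alpha (z ^~ x) t <= c%:E)%E}) ->
  (value P F B mu sigma g t w phi s u_RN <= (w + s * c)%:E)%E.
Proof.
move=> c0 gc; apply: ge_ereal_sup => _ [z admz <-].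
have [mz z0 _ _] := admz.
exact: (expectation_cash_le filF bmB (ltW alpha0) t01 mz z0 w s0 c0 (gc _ admz)).
Qed.

Lemma value_ge (c : R) z : 0 <= c -> admissible P F t phi z ->
  (forall x, gain mt alpha (z ^~ x) t = c%:E) ->
  ((w + s * c)%:E <= value P F B mu sigma g t w phi s u_RN)%E.
Proof.
move=> c0 admz gc; have [mz z0 _ _] := admz.
rewrite -(expectation_cash filF bmB (ltW alpha0) t01 mz z0 w s0 c0 gc).
by apply: ereal_sup_ubound; exists z.
Qed.

Lemma admissible_gain_le_time z : admissible P F t phi z ->
  {ae P, forall x, (gain mt alpha (z ^~ x) t <=
    (Num.sqrt (1 - expR (- 2 * mt * t)) / (2 * Num.sqrt (alpha * mt)))%:E)%E}.
Proof.
move=> [mz z0 _ [M zM]]; have /andP[t0 _] := t01.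
apply: filterE => x; apply: (@gain_le_time _ _ _ M) => //.
  exact: progressively_measurable_path (ltW t0) mz.
by move=> v vt; rewrite z0//= zM.
Qed.

Lemma admissible_gain_le_shares z : admissible P F t phi z ->
  {ae P, forall x, (gain mt alpha (z ^~ x) t <=
   ((1 - expR (- 2 * Num.sqrt (alpha * mt) * phi)) /
    (2 * Num.sqrt (alpha * mt)))%:E)%E}.
Proof.
move=> [mz z0 zphi [M zM]]; have /andP[t0 _] := t01.
apply: filterS zphi => x zphi; apply: (@gain_le_shares _ _ _ M) => //.
- exact: progressively_measurable_path (ltW t0) mz.
- by move=> v vt; rewrite z0//= zM.
- rewrite -lee_fin /Rintegral fineK//.
  rewrite ge0_fin_numE ?(le_lt_trans zphi) ?ltry//.
  by apply: integral_ge0 => v /=; rewrite in_itv/= => vt; rewrite lee_fin z0.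
Qed.

End value.
End strategies.

Section optimal_strategies.
Context {R : realType}.
Local Notation leb := (@lebesgue_measure R).
Variables (mt alpha t phi : R).
Hypotheses (mt0 : 0 < mt) (alpha0 : 0 < alpha) (t0 : 0 < t).

Lemma truncated_ge0 (f : R -> R) tau v : 0 <= f v -> 0 <= truncated f tau v.
Proof. by move=> f0; rewrite mulr_ge0// indicE ler0n. Qed.

Lemma truncated_le (f : R -> R) tau v : 0 <= f v -> truncated f tau v <= f v.
Proof. by move=> f0; rewrite ler_piMr// indicE lern1 leq_b1. Qed.

Lemma integral_zeta2 : 0 <= phi ->
  (\int[leb]_(v in `[0%R, t]) (zeta2_hat mt alpha phi v)%:E <= phi%:E)%E.
Proof.
move=> phi0; rewrite /zeta2_hat; under eq_integral do rewrite EFinM.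
rewrite ge0_integralZl//; last first.
  by apply/measurable_EFinP; exact: measurable_indic.
rewrite integral_indic//.
set tau := phi * _.
have tau0 : 0 <= tau by rewrite mulr_ge0// sqrtr_ge0.
have -> : phi = Num.sqrt (mt / alpha) * tau.
  rewrite /tau mulrCA -sqrtrM ?divr_ge0 ?ltW// (_ : _ / _ * _ = 1).
    by rewrite sqrtr1 mulr1.
  by field; rewrite !gt_eqF.
rewrite EFinM lee_wpmul2l// ?lee_fin ?sqrtr_ge0//.
apply: (@le_trans _ _ (leb `[0, tau]%classic)).
  by apply: le_measure; rewrite ?inE//; apply: measurableI.
rewrite lebesgue_measure_itv/= lte_fin.
by move: tau0; rewrite le_eqVlt => /predU1P[<-|->]; rewrite ?ltxx// -EFinB subr0.
Qed.

Lemma integral_truncated_le (f : R -> R) tau : (forall v, 0 <= f v) ->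
  measurable_fun setT f ->
  (\int[leb]_(v in `[0%R, t]) (truncated f tau v)%:E <=
   \int[leb]_(v in `[0%R, t]) (f v)%:E)%E.
Proof.
move=> f0 mf; apply: ge0_le_integral => //.
- by move=> v _; rewrite lee_fin truncated_ge0.
- by apply/measurable_EFinP; apply: measurable_funTS; exact: measurable_truncated.
- by apply/measurable_EFinP; exact: measurable_funTS.
- by move=> v _; rewrite lee_fin truncated_le.
Qed.

End optimal_strategies.

Theorem theorem2 (d : measure_display) (T : measurableType d) (R : realType)
    (P : probability T R) (F : R -> set (set T)) (B : R -> T -> R)
    (Phi0 mu sigma alpha t w phi s : R)
    (mt := mu - sigma ^+ 2 / 2)
    (g := fun z : R => alpha * z ^+ 2) :
  filtration F -> usual_conditions P F -> standard_brownian_motion P F B ->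
  0 < Phi0 -> 0 <= mu -> 0 <= sigma -> 0 < mt -> 0 < alpha ->
  0 < t <= 1 -> domain Phi0 (w, phi, s) ->
  (Phi1_hat mt alpha t <= phi ->
     value P F B mu sigma g t w phi s u_RN =
       (w + s * Num.sqrt (1 - expR (- 2 * mt * t))
            / (2 * Num.sqrt (alpha * mt)))%:E /\
     optimal_strategy P F B mu sigma g t w phi s
       (fun r _ => zeta1_hat mt alpha t r)) /\
  (phi <= Phi2_hat mt alpha t ->
     value P F B mu sigma g t w phi s u_RN =
       (w + s / (2 * Num.sqrt (alpha * mt))
            * (1 - expR (- 2 * Num.sqrt (alpha * mt) * phi)))%:E /\
     optimal_strategy P F B mu sigma g t w phi s
       (fun r _ => zeta2_hat mt alpha phi r)).
Proof.
move=> filF _ bmB _ _ _ mt0 alpha0 t01 [/= /andP[phi0 _] s0].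
have /andP[t0 t1] := t01.
have a0 : 0 < Num.sqrt (alpha * mt) by rewrite sqrtr_gt0 mulr_gt0.
split => phit.
- set r := Num.sqrt (1 - _).
  have E1 : expR (- 2 * mt * t) < 1.
    by rewrite expR_lt1 -mulrA mulNr oppr_lt0 !mulr_gt0.
  have r0 : 0 < r by rewrite sqrtr_gt0 subr_gt0.
  have r2 : r ^+ 2 = 1 - expR (- 2 * mt * t) by rewrite sqr_sqrtr// subr_ge0 ltW.
  set a := Num.sqrt (alpha * mt) in a0 *.
  (* The gain of [zeta1_hat] stopped at [tau]: continuous in [tau], and equal at [tau = t] to the
     upper bound for all admissible strategies. *)
  pose c tau := (1 - expR (- (2 * mt) * tau)) / (2 * a * r).
  have ct : c t = r / (2 * a).
    rewrite /c (_ : 1 - _ = r ^+ 2); first by field; rewrite !gt_eqF.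
    by rewrite r2 mulNr.
  have c0 tau : 0 <= tau -> 0 <= c tau.
    move=> tau0; rewrite divr_ge0 ?mulr_ge0 ?(ltW a0) ?(ltW r0)// subr_ge0.
    by rewrite expR_le1 mulNr oppr_le0 !mulr_ge0// ltW.
  have mz1 : measurable_fun setT (zeta1_hat mt alpha t) by exact: measurable_zeta1.
  have gain1 tau : 0 <= tau -> tau <= t ->
      gain mt alpha (truncated (zeta1_hat mt alpha t) tau) t = (c tau)%:E.
    by move=> tau0 taut; rewrite gain_zeta1// subr0.
  (* The hypothesis on [phi] enters here: the holding covers everything that [zeta1_hat] sells. *)
  have phi1 : (\int[lebesgue_measure]_(q in `[0%R, t])
      (zeta1_hat mt alpha t q)%:E <= phi%:E)%E.
    by apply: le_trans (integral_zeta1 mt0 alpha0 t0) _; rewrite lee_fin.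
  have V : value P F B mu sigma g t w phi s u_RN = (w + s * r / (2 * a))%:E.
    apply/eqP; rewrite eq_le -mulrA -ct; apply/andP; split.
      apply: value_le => //; first exact/c0/ltW.
      by rewrite ct; move=> z; exact: admissible_gain_le_time.
    (* The lower bound comes from stopping times [tau] strictly below [t], which keep the speed
       bounded, and from letting [tau] tend to [t]. *)
    have cvgV : (w + s * c tau)%:E @[tau --> t^'-] --> (w + s * c t)%:E.
      apply: cvg_EFin; first exact: nearW.
      apply: cvgD; first exact: cvg_cst.
      apply: cvgMr; apply: cvgMl; apply: cvgB; first exact: cvg_cst.
      apply: cvg_at_left_filter; apply: continuous_comp.
        exact: mulrl_continuous.
      exact: continuous_expR.
    apply: (cvge_to_le cvgV).
    near=> tau.
    have tau0 : 0 <= tau by near: tau; exact: nbhs_left_ge.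
    have taut : tau < t by near: tau; exact: nbhs_left_lt.
    have adm : admissible P F t phi
        (fun v _ => truncated (zeta1_hat mt alpha t) tau v).
      split.
      * apply: progressively_measurable_deterministic.
        exact: measurable_truncated.
      * by move=> v _ _; apply: truncated_ge0; exact: zeta1_ge0.
      * apply: filterE => _; apply: le_trans phi1.
        by apply: integral_truncated_le => // v; exact: zeta1_ge0.
      * exists (zeta1_hat mt alpha t tau) => v _ /andP[v0 vt].
        have [vtau|vtau] := boolP (0 <= v <= tau).
          have /andP[_ vtau'] := vtau.
          apply: le_trans (zeta1_le mt0 alpha0 vtau' taut).
          by apply: truncated_le; exact: zeta1_ge0.
        rewrite /truncated indicE memNset ?mulr0 ?zeta1_ge0//= in_itv/=.
        exact/negP.
    apply: (value_ge w filF bmB alpha0 t01 s0 (c0 _ tau0) adm) => _.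
    by rewrite gain1// ltW.
  split; first exact: V.
  split.
  + split.
    * exact: adapted_deterministic.
    * by move=> _; exact: measurable_funTS.
    * by move=> *; exact: zeta1_ge0.
    * by move=> _; exact: phi1.
    * move=> eps /andP[eps0 epst]; exists (zeta1_hat mt alpha t (t - eps)) => v _.
      by move=> /andP[v0 vt]; apply: zeta1_le => //; rewrite gtrBl.
  + rewrite V -mulrA -ct; apply: (expectation_cash filF bmB (ltW alpha0) t01) => //.
    * exact: progressively_measurable_deterministic.
    * by move=> *; exact: zeta1_ge0.
    * exact/c0/ltW.
    (* On [[0, t]] the full strategy coincides with its truncation at [t], whose gain is known. *)
    * move=> _; apply: etrans (gain1 t (ltW t0) (lexx t)).
      by apply: eq_gain => v vt; rewrite /truncated indicE mem_set ?mulr1//= in_itv.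
- set a := Num.sqrt (alpha * mt) in a0 *.
  pose c := (1 - expR (- 2 * a * phi)) / (2 * a).
  have c0 : 0 <= c.
    rewrite divr_ge0 ?mulr_ge0 ?(ltW a0)// subr_ge0.
    by rewrite expR_le1 -mulrA mulNr oppr_le0 !mulr_ge0// ltW.
  have mz2 : measurable_fun setT (zeta2_hat mt alpha phi).
    by apply: measurable_funM => //; exact: measurable_indic.
  have z20 v : 0 <= zeta2_hat mt alpha phi v.
    by rewrite mulr_ge0 ?sqrtr_ge0// indicE ler0n.
  have z2k v : zeta2_hat mt alpha phi v <= Num.sqrt (mt / alpha).
    by rewrite ler_piMr ?sqrtr_ge0// indicE lern1 leq_b1.
  have gain2 : gain mt alpha (zeta2_hat mt alpha phi) t = c%:E by exact: gain_zeta2.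
  have phi2 := integral_zeta2 t mt0 alpha0 phi0.
  have V : value P F B mu sigma g t w phi s u_RN =
      (w + s / (2 * a) * (1 - expR (- 2 * a * phi)))%:E.
    rewrite -mulrA [_^-1 * _]mulrC -/c.
    apply/eqP; rewrite eq_le; apply/andP; split.
      by apply: value_le => // z; exact: admissible_gain_le_shares.
    have adm : admissible P F t phi (fun v _ => zeta2_hat mt alpha phi v).
      split.
      * exact: progressively_measurable_deterministic.
      * by move=> *; exact: z20.
      * by apply: filterE => _; exact: phi2.
      * by exists (Num.sqrt (mt / alpha)) => v _ _; exact: z2k.
    exact: (value_ge w filF bmB alpha0 t01 s0 c0 adm (fun=> gain2)).
  split; first exact: V.
  split.
  + split.
    * exact: adapted_deterministic.
    * by move=> _; exact: measurable_funTS.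
    * by move=> *; exact: z20.
    * by move=> _; exact: phi2.
    * by move=> eps _; exists (Num.sqrt (mt / alpha)) => v _ _; exact: z2k.
  + rewrite V -mulrA [_^-1 * _]mulrC -/c.
    apply: (expectation_cash filF bmB (ltW alpha0) t01) => //.
    exact: progressively_measurable_deterministic.
Unshelve. all: by end_near. Qed.
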